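(* Let $V\subset\mathbb{C}$ be a non-empty bounded open set, and let $g:V\to\mathbb{C}$ be a holomorphic function having a holomorphic continuation to a neighborhood of $\overline{V}$. Let $N\in\mathbb{N}$, $N\geq 1$, and suppose that every $w\in V$ has at least $N$ preimages under $g$ in $V$, counted with multiplicity. Then the topological entropy of $g$ is at least $\log(N)$.
   Context: The multiplicity of a preimage $z$ of $w$ is the order of vanishing of $g-w$ at $z$. The continuation of $g$ to a neighborhood of $\overline V$ is still denoted by $g$. Definition of topological entropy. Let $X\subset \overline V$ be compact, $n\in\mathbb{N}$, $\delta>0$. A set $E\subset X$ is called $(n,\delta)$-separated if (i) for every $z\in E$ the finite orbit $\{z,g(z),\dots,g^{n-1}(z)\}$ is defined and contained in $X$; and (ii) for any $z\neq w$ in $E$ there exists $0\le k\le n-1$ with $|g^k(z)-g^k(w)|>\delta$. Let $K(n,\delta)$ be the maximal cardinality of an $(n,\delta)$-separated set. Set $$h_{\mathrm{top}}(X,g):=\sup_{\delta>0}\Big\{\limsup_{n\to\infty}\frac1n\log K(n,\delta)\Big\}.$$ The topological entropy $h_{\mathrm{top}}(g)$ is the supremum of $h_{\mathrm{top}}(X,g)$ over all compact $X\subset\overline V$. *)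

(* Defs.v *)
From HB Require Import structures.
From mathcomp Require Import all_boot all_order all_algebra.
From mathcomp Require Import complex.
From mathcomp Require Import all_classical all_reals all_analysis.

Set Implicit Arguments.
Unset Strict Implicit.
Unset Printing Implicit Defensive.

Import Order.TTheory GRing.Theory Num.Theory.
Import numFieldNormedType.Exports.

Local Open Scope classical_set_scope.
Local Open Scope ring_scope.

(* [R[i]^o] is the complex field as a normed space over itself, so [open],
   [closure], [compact] refer to the usual topology of the plane and
   [derivable f z 1] is complex differentiability of [f] at [z]. *)
Notation Cplx R := ((complex R)^o).

Section Holomorphic.
Context {R : realType}.
Implicit Types (U : set (Cplx R)) (f : Cplx R -> Cplx R) (z : Cplx R).

Definition holomorphic_on U f := forall z, U z -> derivable f z 1.

Definition has_vanishing_order f z (m : nat) :=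
  exists h : Cplx R -> Cplx R, h z != 0 /\
    \forall u \near z, derivable h u 1 /\ f u = (u - z) ^+ m * h u.

(* The set below has at most one element; it is empty when [f] vanishes
   identically near [z], in which case the order is [+oo]. *)
Definition vanishing_order f z : \bar R :=
  ereal_inf [set (m%:R)%:E | m in has_vanishing_order f z].

Definition preimage_count U f (w : Cplx R) : \bar R :=
  \esum_(z in U `&` f @^-1` [set w]) vanishing_order (fun u => f u - w) z.

End Holomorphic.

(* Only the values of [g] on the sets [X] matter below: every iterate that is
   used is taken at a point of [X]. *)
Section Entropy.
Context {R : realType}.
Implicit Types (X Y E : set (Cplx R)) (g : Cplx R -> Cplx R).

Definition separated_set X g (n : nat) (delta : R) E :=
  [/\ E `<=` X,
      forall z, E z -> forall k, (k < n)%N -> X (iter k g z) &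
      forall z w, E z -> E w -> z <> w ->
        exists2 k, (k < n)%N & delta < Normc.normc (iter k g z - iter k g w)].

Definition max_separated X g (n : nat) (delta : R) : \bar R :=
  ereal_sup [set counting E | E in separated_set X g n delta].

(* [lne 0 = -oo]; the junk value at [n = 0] does not affect the limsup. *)
Definition entropy_on X g : \bar R :=
  ereal_sup [set limn_esup
      (fun n => (n%:R^-1)%:E * lne (max_separated X g n delta))%E
    | delta in [set delta : R | 0 < delta]].

Definition topological_entropy Y g : \bar R :=
  ereal_sup [set entropy_on X g | X in [set X | compact X /\ X `<=` Y]].

End Entropy.

(* Main.v *)
Require Import Defs.
From HB Require Import structures.
From mathcomp Require Import all_boot all_order all_algebra.
From mathcomp Require Import complex.
From mathcomp Require Import all_classical all_reals all_analysis.
From mathcomp Require Import ring lra.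
Set Implicit Arguments.
Unset Strict Implicit.
Unset Printing Implicit Defensive.
Import Order.TTheory GRing.Theory Num.Theory.
Import numFieldNormedType.Exports.
Local Open Scope classical_set_scope.
Local Open Scope ring_scope.

(** Only finite orbits matter for separated sets, so it is enough to find, for
    every [q], a scale [delta] at which the closure [K] of [V] contains, for all
    large [n], separated sets of about [N ^ (n - n / q)] points.  They are
    preimages under [iter n g] of one well chosen point [y] of [V].

    Call a point good if [|g'| >= eps] there and bad otherwise, and build
    backward orbits inside [V].  If a point has a bad preimage, follow that one
    only; otherwise all its preimages are simple, hence there are [N] distinct
    ones, and all are followed.  By strict differentiability and compactness,
    two distinct good points with the same image are more than [delta] apart,
    so the branches of this tree are separated, and a tree whose branches all
    have at least [m] good points has at least [N ^ m] leaves
    ([preimage_tree]).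

    The point [y] has to exclude branches with many bad points.  With [|g'| <= L]
    on [K] and [eps] a large negative power of [2 * L], an orbit of length [n]
    with more than [n / q] bad points has multiplier at most [2 ^- n]
    ([few_good_small_multiplier]).  On the set of these orbits [iter n g]
    contracts small distances by the factor [2 * 2 ^- n], so its image cannot
    fill a disc of fixed radius: [K] is covered by about [m ^ 2] small squares,
    whereas the disc contains slightly more grid points at mutual distance
    proportional to [1 / m] ([contraction_misses_point]).

    Two facts on holomorphic functions are used: they are strictly
    differentiable ([holomorphic_strict]), and they take a value with
    multiplicity at most one where the derivative is nonzero
    ([vanishing_order_le1]).  Both follow from the identity
    [f x - f y = (x - y) * S x y] with [S] jointly continuous and differentiable
    in [x] ([holomorphic_slope]), and [S] comes from the Cauchy formula on the
    boundary of a square ([cauchy_formula]).  The latter is obtained from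
    Goursat's theorem for triangles ([goursat]), for line integrals along
    segments defined as limits of trapezoidal sums. *)

(** The modulus as a real number: the library norm of a complex number is
    itself complex. *)
Local Notation nc := Normc.normc.

(** * The plane with real tolerances *)

Section PlaneMetric.
Context {R : realType}.
Local Notation C := (Cplx R).
Implicit Types (z w : C).

Lemma normcE_complex z : `|z| = (nc z)%:C%C.
Proof. by []. Qed.

Lemma nc_ge0 z : 0 <= nc z.
Proof. by case: z => a b; exact: sqrtr_ge0. Qed.

Lemma nc_eq0 z : (nc z == 0) = (z == 0).
Proof.
by apply/eqP/eqP => [/Normc.eq0_normc//|->]; rewrite Normc.normc0.
Qed.

Lemma nc_gt0 z : (0 < nc z) = (z != 0).
Proof. by rewrite lt_neqAle nc_ge0 andbT eq_sym nc_eq0. Qed.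

Lemma ncM z w : nc (z * w) = nc z * nc w.
Proof. exact: Normc.normcM. Qed.

Lemma ncV z : nc z^-1 = (nc z)^-1.
Proof. exact: Normc.normcV. Qed.

Lemma ncN z : nc (- z) = nc z.
Proof. exact: (normcN z). Qed.

Lemma ncD z w : nc (z + w) <= nc z + nc w.
Proof. exact: (le_normcD z w). Qed.

Lemma ncB z w : nc (z - w) <= nc z + nc w.
Proof. by rewrite -(ncN w); exact: ncD. Qed.

Lemma nc_sym z w : nc (z - w) = nc (w - z).
Proof. by rewrite -ncN opprB. Qed.

Lemma nc_split u z w : nc (z - w) <= nc (z - u) + nc (u - w).
Proof.
have -> : z - w = (z - u) + (u - w) by rewrite addrA subrK.
exact: ncD.
Qed.

Lemma ncX z n : nc (z ^+ n) = nc z ^+ n.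
Proof.
elim: n => [|n IH]; first by rewrite !expr0 Normc.normc1.
by rewrite !exprS ncM IH.
Qed.

Lemma nc_real (r : R) : nc (r%:C%C : C) = `|r|.
Proof. by rewrite /= expr0n /= addr0 sqrtr_sqr. Qed.

Lemma nc_nat n : nc (n%:R : C) = n%:R :> R.
Proof.
have -> : (n%:R : C) = (n%:R)%:C%C by rewrite rmorph_nat.
by rewrite nc_real ger0_norm.
Qed.

Lemma Re_le_nc z : `|complex.Re z| <= nc z.
Proof.
case: z => a b /=; rewrite -sqrtr_sqr ler_wsqrtr //.
by rewrite lerDl sqr_ge0.
Qed.

Lemma Im_le_nc z : `|complex.Im z| <= nc z.
Proof.
case: z => a b /=; rewrite -sqrtr_sqr ler_wsqrtr //.
by rewrite lerDr sqr_ge0.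
Qed.

Lemma nc_le_ReIm z : nc z <= `|complex.Re z| + `|complex.Im z|.
Proof.
case: z => a b.
have -> : (a +i* b)%C = (a +i* 0)%C + (0 +i* b)%C :> C.
  by rewrite /GRing.add /= addr0 add0r.
apply: (le_trans (ncD _ _)) => /=.
by rewrite !expr0n /= !addr0 !add0r !sqrtr_sqr.
Qed.

Lemma complex_gt0E (e : R[i]) : 0 < e -> 0 < complex.Re e /\ e = (complex.Re e)%:C%C.
Proof. by case: e => a b; rewrite ltcE /= => /andP[/eqP -> ->]. Qed.

Lemma nbhs_ncP z (P : C -> Prop) :
  (\forall u \near z, P u) <->
  exists2 r : R, 0 < r & forall u, nc (u - z) < r -> P u.
Proof.
split.
  move=> /nbhs_ballP[e /= e0 He].
  have [r0 er] := complex_gt0E e0.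
  exists (complex.Re e) => // u hu; apply: He.
  by rewrite -ball_normE /ball_ /= er normcE_complex ltcR nc_sym.
move=> [r r0 H]; apply/nbhs_ballP; exists (r%:C%C) => /=; first by rewrite ltcR.
move=> u; rewrite -ball_normE /ball_ /= normcE_complex ltcR nc_sym.
exact: H.
Qed.

Lemma open_ncP (A : set C) z : open A -> A z ->
  exists2 r : R, 0 < r & forall u, nc (u - z) < r -> A u.
Proof.
by move=> oA Az; apply/nbhs_ncP; exact: open_nbhs_nbhs.
Qed.

Lemma closure_ncP (A : set C) z :
  closure A z <-> forall r : R, 0 < r -> exists2 u, A u & nc (u - z) < r.
Proof.
split=> [cA r r0|H B /nbhs_ncP[r r0 HB]].
  have [|u [Au ur]] := cA [set u | nc (u - z) < r]; last by exists u.
  by apply/nbhs_ncP; exists r.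
by have [u Au ur] := H r r0; exists u; split => //; apply: HB.
Qed.

(** The tolerances are real, while those of [derivable] are positive elements of
    the complex field. *)
Definition has_cderiv (f : C -> C) z d := forall e : R, 0 < e ->
  exists2 r : R, 0 < r & forall u, nc (u - z) < r ->
    nc (f u - f z - d * (u - z)) <= e * nc (u - z).

Lemma derivable_has_cderiv f z :
  derivable f z 1 -> exists d, has_cderiv f z d.
Proof.
move=> /cvg_ex[l hl]; exists l => e e0.
move/cvgrPdist_le: hl => /(_ e%:C%C); rewrite ltcR => /(_ e0).
move=> /nbhs_ballP[r /= r0 H].
have [r0' er] := complex_gt0E r0.
exists (complex.Re r) => // u hu.
have [->|uz] := eqVneq u z.
  by rewrite !subrr mulr0 subrr Normc.normc0 mulr0.
have uz0 : u - z != 0 by rewrite subr_eq0.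
have := H (u - z); rewrite -ball_normE /ball_ /= sub0r.
rewrite normrN er normcE_complex ltcR => /(_ hu uz0).
rewrite normcE_complex lecR.
have -> : (u - z)%:A + z = u :> C by rewrite /GRing.scale /= mulr1 subrK.
rewrite /GRing.scale /= => hle.
have -> : f u - f z - l * (u - z) =
   - ((u - z) * (l - (u - z)^-1 * (f u - f z))).
  by rewrite [in RHS]mulrBr mulVKf // opprB [l * _]mulrC.
by rewrite ncN ncM mulrC ler_wpM2r // nc_ge0.
Qed.

Lemma has_cderiv_derivable f z d : has_cderiv f z d -> derivable f z 1.
Proof.
move=> H; apply/cvg_ex; exists d; apply/cvgrPdist_le => e e0.
have [e0' ee] := complex_gt0E e0.
have [r r0 Hr] := H _ e0'.
apply/nbhs_ballP; exists (r%:C%C) => /=; first by rewrite ltcR.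
move=> h; rewrite -ball_normE /ball_ /= sub0r normrN normcE_complex ltcR.
move=> hr h0; have -> : h%:A + z = h + z :> C by rewrite /GRing.scale /= mulr1.
have := Hr (h + z); rewrite addrK => /(_ hr) hle.
rewrite normcE_complex ee lecR.
have -> : d - h^-1 *: (f (h + z) - f z) = - (h^-1 * (f (h + z) - f z - d * h)).
  by rewrite mulrBr [d * h]mulrC mulKf // opprB.
rewrite ncN ncM ncV mulrC ler_pdivrMr ?nc_gt0 //.
Qed.

Definition continuous_nc (f : C -> C) z := forall e : R, 0 < e ->
  exists2 r : R, 0 < r & forall u, nc (u - z) < r -> nc (f u - f z) < e.

Lemma has_cderiv_continuous f z d : has_cderiv f z d -> continuous_nc f z.
Proof.
move=> H e e0; have [r r0 Hr] := H 1 ltr01.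
have K0 : 0 < 1 + nc d by rewrite ltr_pwDl // nc_ge0.
exists (Num.min r (e / (1 + nc d))).
  by rewrite lt_min r0 divr_gt0.
move=> u; rewrite lt_min => /andP[ur ue].
have -> : f u - f z = (f u - f z - d * (u - z)) + d * (u - z) by rewrite subrK.
apply: (le_lt_trans (ncD _ _)).
apply: (@le_lt_trans _ _ ((1 + nc d) * nc (u - z))).
  by rewrite mulrDl ncM lerD2r; exact: Hr.
by rewrite mulrC -ltr_pdivlMr.
Qed.

(** Lebesgue numbers: a property of pairs that holds near each point of a
    compact set, with local constants, holds with uniform constants. *)
Lemma compact_uniform (K : set C) (P : R -> C -> C -> Prop) : compact K ->
  (forall A B x y, A <= B -> P A x y -> P B x y) ->
  (forall p, K p -> exists r A : R, 0 < r /\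
     forall x y, nc (x - p) < r -> nc (y - p) < r -> P A x y) ->
  exists r A : R, 0 < r /\ forall x y, K x -> nc (y - x) < r -> P A x y.
Proof.
move=> /compact_near_coveringP cK mono loc.
have := cK nat \oo (fun i x => forall y, nc (y - x) < (i.+1%:R)^-1 ->
  P i%:R x y) _.
case.
  move=> p /loc[r [A [r0 H]]].
  have r20 : 0 < r / 2 by rewrite divr_gt0.
  have rE : r / 2 + r / 2 = r by rewrite -splitr.
  exists ([set x | nc (x - p) < r / 2],
    [set i : nat | A <= i%:R /\ (i.+1%:R)^-1 < r / 2]) => /=.
    split; first by apply/nbhs_ncP; exists (r / 2).
    near=> i; split.
      near: i; exact: nbhs_infty_ger.
    near: i; exact: (near_infty_natSinv_lt (PosNum r20)).
  move=> [x i] /= [xp [Ai ir]] y yx.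
  apply: (mono A) => //; apply: H; first by rewrite -rE ltr_wpDr // ltW.
  apply: (le_lt_trans (nc_split x _ _)); rewrite -rE ltrD //.
  exact: lt_trans ir.
move=> N _ /(_ N (leqnn N)) H.
exists (N.+1%:R)^-1, N%:R; split; first by rewrite invr_gt0.
by move=> x y Kx; exact: H.
Unshelve. all: by end_near. Qed.

Lemma compact_square (M : R) :
  compact [set z : C | `|complex.Re z| <= M /\ `|complex.Im z| <= M].
Proof.
pose f (u : R * R) : C := (u.1 +i* u.2)%C.
have -> : [set z : C | `|complex.Re z| <= M /\ `|complex.Im z| <= M] =
  f @` (`[- M, M] `*` `[- M, M]).
  apply/seteqP; split => [[a b] /= [ha hb]|_ [[a b] /= [ha hb] <-]].
    by exists (a, b) => //=; rewrite !in_itv /= -!ler_norml.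
  by move: ha hb; rewrite !in_itv /= -!ler_norml.
apply: continuous_compact; last by apply: compact_setX; exact: segment_compact.
apply: continuous_subspaceT => -[a b]; apply/cvgrPdist_lt => e e0.
have [e0' ee] := complex_gt0E e0.
have e20 : 0 < complex.Re e / 2 by rewrite divr_gt0.
exists (ball a (complex.Re e / 2), ball b (complex.Re e / 2)) => /=.
  by split; apply: nbhsx_ballx.
move=> [x y] /= []; rewrite -!ball_normE /ball_ /= => ha hb.
rewrite normcE_complex ee ltcR; apply: (le_lt_trans (nc_le_ReIm _)) => /=.
lra.
Qed.

Lemma compact_closure_bounded (V : set C) : bounded_set V ->
  compact (closure V) /\
  exists2 M : R, 0 < M & forall z, closure V z -> nc z <= M.
Proof.
move=> [M [Mreal HM]].
pose m := complex.Re M.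
have bV z : V z -> nc z <= `|m| + 1.
  move=> Vz; have Mm : M < (`|m| + 1)%:C%C.
    move: Mreal; rewrite /m; case: M {HM m} => a b /=.
    rewrite complex_real => /eqP -> /=; rewrite ltcR.
    by rewrite ltr_pwDr // ler_norm.
  by have := HM _ Mm z Vz; rewrite /= normcE_complex lecR.
have cV z : closure V z -> nc z <= `|m| + 2.
  move=> /closure_ncP/(_ 1 ltr01)[u Vu uz].
  have := nc_split u z 0; rewrite !subr0 nc_sym => h.
  have := bV u Vu; lra.
split; last by exists (`|m| + 2) => //; have := normr_ge0 m; lra.
apply: (subclosed_compact _ (@compact_square (`|m| + 2))).
  exact: closed_closure.
move=> z /cV h; split; apply: le_trans h; [exact: Re_le_nc|exact: Im_le_nc].
Qed.

End PlaneMetric.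

(** * Mean values along segments *)

Section SegmentAverage.
Context {R : realType}.
Local Notation C := (Cplx R).
Implicit Types (z w p q : C) (phi psi : C -> C).

Lemma cvg_ncP (u : nat -> C) (l : C) : u @ \oo --> l <->
  forall e : R, 0 < e -> exists N, forall n, (N <= n)%N -> nc (u n - l) < e.
Proof.
split=> [/cvgrPdist_lt ul e e0|H].
  have := ul e%:C%C; rewrite ltcR => /(_ e0)[N _ HN].
  by exists N => n /HN; rewrite /= normcE_complex ltcR nc_sym.
apply/cvgrPdist_lt => e e0; have [e0' ->] := complex_gt0E e0.
have [N HN] := H _ e0'; exists N => // n /= /HN.
by rewrite normcE_complex ltcR nc_sym.
Qed.

(** Completeness of the plane, from that of the line for both coordinates; the
    tolerance only compares with a fixed term [u N]. *)
Lemma cauchy_nc_cvg (u : nat -> C) :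
  (forall e : R, 0 < e -> exists N, forall n, (N <= n)%N -> nc (u n - u N) < e) ->
  cvg (u @ \oo).
Proof.
move=> H.
have part (g : C -> R) : (forall z w, `|g z - g w| <= nc (z - w)) ->
    cvg (g \o u @ \oo).
  move=> gle; apply: cauchy_cvg; apply/cauchy_ballP => e e0.
  have e20 : 0 < e / 2 by rewrite divr_gt0.
  have [N HN] := H _ e20.
  have tail : \forall n \near \oo, ball (g (u N)) (e / 2) ((g \o u) n).
    exists N => // n /= /HN h; rewrite -ball_normE /ball_ /= distrC.
    exact: le_lt_trans h.
  near=> x y; apply: (ball_splitr (z := g (u N))).
  - near: x; exact: tail.
  - near: y; exact: tail.
have /cvg_ex[a ha] := part (fun z => complex.Re z)
  (fun z w => ltac:(have := Re_le_nc (z - w); by case: z w => [? ?] [? ?])).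
have /cvg_ex[b hb] := part (fun z => complex.Im z)
  (fun z w => ltac:(have := Im_le_nc (z - w); by case: z w => [? ?] [? ?])).
apply/cvg_ex; exists (a +i* b)%C; apply/cvg_ncP => e e0.
have e20 : 0 < e / 2 by rewrite divr_gt0.
move/cvgrPdist_lt: ha => /(_ _ e20)[N1 _ H1].
move/cvgrPdist_lt: hb => /(_ _ e20)[N2 _ H2].
exists (maxn N1 N2) => n; rewrite geq_max => /andP[/H1 /= h1 /H2 /= h2].
rewrite nc_sym; apply: (le_lt_trans (nc_le_ReIm _)).
move: h1 h2; case: (u n) => x y /=; lra.
Unshelve. all: by end_near. Qed.

Definition segm p q : set C :=
  [set p + t%:C%C * (q - p) | t in [set t : R | 0 <= t <= 1]].

Definition mid p q : C := (p + q) / 2.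

Lemma midC p q : mid p q = mid q p.
Proof. by rewrite /mid addrC. Qed.

Lemma segm_l p q : segm p q p.
Proof. by exists 0; rewrite /= ?lexx ?ler01 // mul0r addr0. Qed.

Lemma segm_sym p q z : segm p q z -> segm q p z.
Proof.
move=> [t /= /andP[t0 t1] <-]; exists (1 - t).
  by rewrite /= subr_ge0 t1 lerBlDr lerDl t0.
by rewrite rmorphB rmorph1; ring.
Qed.

Lemma segm_r p q : segm p q q.
Proof. by apply: segm_sym; exact: segm_l. Qed.

Lemma segm_midl p q z : segm p (mid p q) z -> segm p q z.
Proof.
move=> [t /= /andP[t0 t1] <-]; exists (t / 2).
  by rewrite /= divr_ge0 //= ler_pdivrMr // mul1r (le_trans t1) // ler1n.
rewrite rmorphM fmorphV rmorph_nat /mid; by field.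
Qed.

Lemma segm_midr p q z : segm (mid p q) q z -> segm p q z.
Proof.
move=> /segm_sym; rewrite midC => /segm_midl; exact: segm_sym.
Qed.

Lemma mid_subl p q : mid p q - p = (q - p) / 2.
Proof. rewrite /mid; by field. Qed.

Lemma mid_subr p q : q - mid p q = (q - p) / 2.
Proof. rewrite /mid; by field. Qed.

Lemma nc_half z : nc (z / 2) = nc z / 2.
Proof. by rewrite ncM ncV nc_nat. Qed.

Lemma segm_diam p q z w : segm p q z -> segm p q w -> nc (z - w) <= nc (q - p).
Proof.
move=> [t /= /andP[t0 t1] <-] [s /= /andP[s0 s1] <-].
have -> : p + t%:C%C * (q - p) - (p + s%:C%C * (q - p)) = (t - s)%:C%C * (q - p).
  by rewrite rmorphB; ring.
rewrite ncM nc_real ler_piMl ?nc_ge0 //.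
by rewrite ler_norml; apply/andP; split; lra.
Qed.

Lemma compact_segm p q : compact (segm p q).
Proof.
have -> : segm p q = (fun t : R => p + t%:C%C * (q - p)) @` `[0, 1].
  by apply/seteqP; split => z [t ht <-]; exists t => //=; move: ht; rewrite /= in_itv.
apply: continuous_compact; last exact: segment_compact.
apply: continuous_subspaceT => t; apply/cvgrPdist_lt => e e0.
have [e0' ee] := complex_gt0E e0.
have K0 : 0 < 1 + nc (q - p) by rewrite ltr_pwDl // nc_ge0.
have d0 : 0 < complex.Re e / (1 + nc (q - p)) by rewrite divr_gt0.
apply: filterS (nbhsx_ballx t _ d0) => s; rewrite -ball_normE /ball_ /= => hs.
rewrite normcE_complex ee ltcR.
have -> : p + t%:C%C * (q - p) - (p + s%:C%C * (q - p)) = (t - s)%:C%C * (q - p).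
  by rewrite rmorphB; ring.
rewrite ncM nc_real; move: hs; rewrite ltr_pdivlMr //; apply: le_lt_trans.
by rewrite ler_wpM2l // lerDr.
Qed.

(** The midpoint recursion makes symmetry and additivity at the midpoint hold by
    construction, and it is exact on affine functions at every level: these are
    the properties of line integrals on which Goursat's argument rests. *)
Fixpoint trapezoid phi k p q : C :=
  if k is k'.+1 then
    (trapezoid phi k' p (mid p q) + trapezoid phi k' (mid p q) q) / 2
  else (phi p + phi q) / 2.

Definition seg_mean phi p q : C := lim ((fun k => trapezoid phi k p q) @ \oo).

(** Trapezoidal sums are iterated midpoints of values, so they stay in every
    midpoint-convex set that contains the values: discs give norm bounds,
    half-planes give bounds on real parts. *)
Lemma trapezoid_convex (P : C -> Prop) phi k p q :
  (forall z w, P z -> P w -> P ((z + w) / 2)) ->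
  (forall z, segm p q z -> P (phi z)) -> P (trapezoid phi k p q).
Proof.
move=> Pc; elim: k p q => [|k IH] p q H /=.
  by apply: Pc; apply: H; [exact: segm_l|exact: segm_r].
by apply: Pc; apply: IH => z hz; apply: H; [exact: segm_midl|exact: segm_midr].
Qed.

Lemma half_convex_ball (c : C) (B : R) z w :
  nc (z - c) <= B -> nc (w - c) <= B -> nc ((z + w) / 2 - c) <= B.
Proof.
move=> hz hw; have -> : (z + w) / 2 - c = ((z - c) + (w - c)) / 2.
  by field.
rewrite nc_half ler_pdivrMr // mulr_natr mulr2n.
by apply: (le_trans (ncD _ _)); exact: lerD.
Qed.

Lemma trapezoid_sym phi k p q : trapezoid phi k p q = trapezoid phi k q p.
Proof.
elim: k p q => [|k IH] p q /=; first by rewrite addrC.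
by rewrite (IH p) (IH _ q) (midC q p) addrC.
Qed.

Lemma trapezoid_linear phi psi (a b : C) k p q :
  trapezoid (fun z => a * phi z + b * psi z) k p q =
  a * trapezoid phi k p q + b * trapezoid psi k p q.
Proof.
elim: k p q => [|k IH] p q /=; last rewrite !IH; by field.
Qed.

Lemma trapezoid_affine (a b : C) k p q :
  trapezoid (fun z => a * z + b) k p q = a * mid p q + b.
Proof.
elim: k p q => [|k IH] p q /=; last rewrite !IH; rewrite /mid;
  by field.
Qed.

Lemma trapezoid_ext phi psi k p q : (forall z, segm p q z -> phi z = psi z) ->
  trapezoid phi k p q = trapezoid psi k p q.
Proof.
elim: k p q => [|k IH] p q H /=.
  by rewrite !H //; [exact: segm_r|exact: segm_l].
by congr ((_ + _) / _); apply: IH => z hz; apply: H;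
  [exact: segm_midl|exact: segm_midr].
Qed.

(** Below level [k] only the oscillation of [phi] on subsegments of relative
    length [2 ^- k] counts; this is the Cauchy criterion for the sums. *)
Lemma trapezoid_refine phi k j p q (B : R) :
  (forall z w, segm p q z -> segm p q w ->
     nc (z - w) <= nc (q - p) / 2 ^+ k -> nc (phi z - phi w) <= B) ->
  nc (trapezoid phi (k + j) p q - trapezoid phi k p q) <= B.
Proof.
elim: k p q => [|k IH] p q H.
  have H' z w : segm p q z -> segm p q w -> nc (phi z - phi w) <= B.
    move=> hz hw; apply: H => //; rewrite expr0 divr1; exact: segm_diam.
  rewrite add0n.
  apply: (@trapezoid_convex (fun z => nc (z - _) <= B)).
    by move=> z w; exact: half_convex_ball.
  move=> z hz /=; rewrite nc_sym.
  by apply: half_convex_ball; apply: H' => //; [exact: segm_l|exact: segm_r].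
rewrite addSn /=.
set a := trapezoid _ _ p _; set b := trapezoid _ _ _ q.
set c := trapezoid _ _ p _; set d := trapezoid _ _ _ q.
have -> : (a + b) / 2 - (c + d) / 2 = ((a - c) + (b - d)) / 2.
  by field.
rewrite nc_half ler_pdivrMr // mulr_natr mulr2n.
apply: (le_trans (ncD _ _)); apply: lerD; apply: IH => z w hz hw zw.
  apply: H; [exact: segm_midl|exact: segm_midl|].
  by apply: (le_trans zw); rewrite mid_subl nc_half exprS invfM mulrA.
apply: H; [exact: segm_midr|exact: segm_midr|].
by apply: (le_trans zw); rewrite mid_subr nc_half exprS invfM mulrA.
Qed.

Definition continuous_on_segm phi p q := forall z, segm p q z -> continuous_nc phi z.

Lemma trapezoid_cvg phi p q : continuous_on_segm phi p q ->
  (fun k => trapezoid phi k p q) @ \oo --> seg_mean phi p q.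
Proof.
move=> cphi; apply: cauchy_nc_cvg => e e0.
have e20 : 0 < e / 2 by rewrite divr_gt0.
have [r [_ [r0 Hr]]] : exists r A : R, 0 < r /\
    forall x y, segm p q x -> nc (y - x) < r -> nc (phi x - phi y) < e / 2.
  apply: (@compact_uniform _ _ (fun _ x y => nc (phi x - phi y) < e / 2)).
  - exact: compact_segm.
  - by [].
  move=> z /cphi cz; have e40 : 0 < e / 4 by rewrite divr_gt0.
  have [r r0 Hr] := cz _ e40; exists r, 0; split=> // x y /Hr hx /Hr hy.
  apply: (le_lt_trans (nc_split (phi z) _ _)); rewrite [nc (_ - phi y)]nc_sym.
  lra.
have [N HN] : exists N, nc (q - p) / 2 ^+ N < r.
  have Lr : 0 < r / (1 + nc (q - p)) by rewrite divr_gt0 // ltr_pwDl // nc_ge0.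
  have [N _ /(_ N (leqnn N)) /= hN] := near_infty_natSinv_expn_lt (PosNum Lr).
  exists N; move: hN; rewrite div1r ltr_pdivlMr ?ltr_pwDl ?nc_ge0 // mulrC.
  by apply: le_lt_trans; rewrite ler_wpM2r ?invr_ge0 ?exprn_ge0 // lerDr.
exists N => n Nn; rewrite -(subnKC Nn).
apply: (@le_lt_trans _ _ (e / 2)); last first.
  by rewrite ltr_pdivrMr // mulr_natr mulr2n ltrDl.
apply: trapezoid_refine => z w hz _ zw; apply/ltW/Hr => //.
by rewrite nc_sym; exact: le_lt_trans HN.
Qed.

Lemma seg_mean_unique phi p q l : continuous_on_segm phi p q ->
  (fun k => trapezoid phi k p q) @ \oo --> l -> seg_mean phi p q = l.
Proof. by move=> /trapezoid_cvg h1 h2; exact: (cvg_unique _ h1 h2). Qed.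

Lemma seg_mean_ext phi psi p q : (forall z, segm p q z -> phi z = psi z) ->
  seg_mean phi p q = seg_mean psi p q.
Proof.
move=> H; rewrite /seg_mean; congr (lim (_ @ \oo)); apply/funext => k.
exact: trapezoid_ext.
Qed.

Lemma seg_mean_sym phi p q : seg_mean phi p q = seg_mean phi q p.
Proof.
rewrite /seg_mean; congr (lim (_ @ \oo)); apply/funext => k.
exact: trapezoid_sym.
Qed.

Lemma continuous_on_segm_linear phi psi (a b : C) p q :
  continuous_on_segm phi p q -> continuous_on_segm psi p q ->
  continuous_on_segm (fun z => a * phi z + b * psi z) p q.
Proof.
have aux (c x d : C) (e : R) : 0 < e -> nc (x - d) < e / (1 + nc c) / 2 ->
    nc (c * x - c * d) < e / 2.
  move=> e0; rewrite -mulrBr ncM mulrAC ltr_pdivlMr ?ltr_pwDl ?nc_ge0 //.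
  by apply: le_lt_trans; rewrite mulrC ler_wpM2l ?nc_ge0 // lerDr.
move=> c1 c2 z hz e e0.
have [|r1 r10 H1] := c1 z hz (e / (1 + nc a) / 2).
  by rewrite !divr_gt0 // ltr_pwDl // nc_ge0.
have [|r2 r20 H2] := c2 z hz (e / (1 + nc b) / 2).
  by rewrite !divr_gt0 // ltr_pwDl // nc_ge0.
exists (Num.min r1 r2); first by rewrite lt_min r10.
move=> u; rewrite lt_min => /andP[/H1 h1 /H2 h2].
have -> : a * phi u + b * psi u - (a * phi z + b * psi z) =
  (a * phi u - a * phi z) + (b * psi u - b * psi z) by ring.
apply: (le_lt_trans (ncD _ _)); rewrite [ltRHS]splitr.
by apply: ltrD; exact: aux.
Qed.

Lemma seg_mean_linear phi psi (a b : C) p q :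
  continuous_on_segm phi p q -> continuous_on_segm psi p q ->
  seg_mean (fun z => a * phi z + b * psi z) p q =
  a * seg_mean phi p q + b * seg_mean psi p q.
Proof.
move=> c1 c2; apply: seg_mean_unique; first exact: continuous_on_segm_linear.
under eq_fun do rewrite trapezoid_linear.
by apply: cvgD; apply: cvgM; (try exact: cvg_cst); exact: trapezoid_cvg.
Qed.

Lemma continuous_affine (a b z : C) : continuous_nc (fun z => a * z + b) z.
Proof.
apply: (@has_cderiv_continuous _ _ _ a) => e e0; exists 1 => // u _.
have -> : a * u + b - (a * z + b) - a * (u - z) = 0 by ring.
by rewrite Normc.normc0 mulr_ge0 ?nc_ge0 // ltW.
Qed.

Lemma seg_mean_affine (a b : C) p q :
  seg_mean (fun z => a * z + b) p q = a * mid p q + b.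
Proof.
apply: seg_mean_unique; first by move=> z _; exact: continuous_affine.
under eq_fun do rewrite trapezoid_affine.
exact: cvg_cst.
Qed.

Lemma seg_mean_mid phi p q : continuous_on_segm phi p q ->
  seg_mean phi p q =
  (seg_mean phi p (mid p q) + seg_mean phi (mid p q) q) / 2.
Proof.
move=> cphi; apply: seg_mean_unique => //.
rewrite -cvg_shiftS /=; apply: cvgM; last exact: cvg_cst.
by apply: cvgD; apply: trapezoid_cvg => z hz; apply: cphi;
  [exact: segm_midl|exact: segm_midr].
Qed.

Lemma seg_mean_bound phi p q (c : C) (B : R) : continuous_on_segm phi p q ->
  (forall z, segm p q z -> nc (phi z - c) <= B) ->
  nc (seg_mean phi p q - c) <= B.
Proof.
move=> /trapezoid_cvg/cvg_ncP cv H; apply/ler_addgt0Pl => e /cv[N /(_ N (leqnn N))].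
rewrite nc_sym => h; apply: (le_trans (nc_split (trapezoid phi N p q) _ _)).
apply: lerD; first exact: ltW.
apply: (@trapezoid_convex (fun z => nc (z - c) <= B)) => //.
by move=> z w; exact: half_convex_ball.
Qed.

Lemma Re_half z : complex.Re (z / 2) = complex.Re z / 2.
Proof.
have -> : (2 : C)^-1 = (2^-1)%:C%C by rewrite fmorphV rmorph_nat.
by case: z => a b /=; rewrite mulr0 subr0.
Qed.

Lemma seg_mean_Re_ge phi p q (B : R) : continuous_on_segm phi p q ->
  (forall z, segm p q z -> B <= complex.Re (phi z)) ->
  B <= complex.Re (seg_mean phi p q).
Proof.
move=> /trapezoid_cvg/cvg_ncP cv H; apply/ler_addgt0Pl => e /cv[N /(_ N (leqnn N))].
have : B <= complex.Re (trapezoid phi N p q).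
  apply: (@trapezoid_convex (fun z => B <= complex.Re z)) => // z w hz hw.
  rewrite Re_half; move: hz hw; case: z w => [a b] [a' b'] /=; lra.
move: (trapezoid _ _ _ _) (seg_mean _ _ _) => a b h1 h2.
have := Re_le_nc (a - b); rewrite ler_norml; move: h1 h2.
by case: a b => [? ?] [? ?] /= h1 h2 /andP[]; lra.
Qed.

End SegmentAverage.

(** * Goursat's theorem for triangles *)

Section Goursat.
Context {R : realType}.
Local Notation C := (Cplx R).
Implicit Types (z w p q a b c : C) (phi psi : C -> C) (S : set C).

Definition seg_int phi p q : C := (q - p) * seg_mean phi p q.

Definition tri_int phi a b c : C :=
  seg_int phi a b + seg_int phi b c + seg_int phi c a.

Definition seg_convex S := forall p q, S p -> S q -> segm p q `<=` S.

Lemma seg_int_sym phi p q : seg_int phi q p = - seg_int phi p q.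
Proof. by rewrite /seg_int seg_mean_sym -mulNr opprB. Qed.

Lemma seg_int_mid phi p q : continuous_on_segm phi p q ->
  seg_int phi p q = seg_int phi p (mid p q) + seg_int phi (mid p q) q.
Proof.
move=> cphi; rewrite /seg_int seg_mean_mid // mid_subl mid_subr; by field.
Qed.

Lemma segm_mid p q : segm p q (mid p q).
Proof. by apply: segm_midl; exact: segm_r. Qed.

Lemma tri_int_subdivide S phi a b c : seg_convex S ->
  (forall z, S z -> continuous_nc phi z) -> S a -> S b -> S c ->
  tri_int phi a b c =
    tri_int phi a (mid a b) (mid c a) + tri_int phi (mid a b) b (mid b c)
    + tri_int phi (mid c a) (mid b c) c
    + tri_int phi (mid a b) (mid b c) (mid c a).
Proof.
move=> cS cphi Sa Sb Sc.
have cont p q : S p -> S q -> continuous_on_segm phi p q.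
  by move=> Sp Sq z hz; apply: cphi; exact: cS hz.
rewrite /tri_int (seg_int_mid (cont _ _ Sa Sb)) (seg_int_mid (cont _ _ Sb Sc)).
rewrite (seg_int_mid (cont _ _ Sc Sa)).
rewrite (seg_int_sym _ (mid a b) (mid c a)) (seg_int_sym _ (mid a b) (mid b c)).
rewrite (seg_int_sym _ (mid b c) (mid c a)).
ring.
Qed.

Definition tri_size_le a b c (D : R) :=
  [/\ nc (b - a) <= D, nc (c - b) <= D & nc (a - c) <= D].

Lemma nc_halfle z (D : R) : nc z <= D -> nc (z / 2) <= D / 2.
Proof. by move=> h; rewrite nc_half ler_wpM2r. Qed.

Lemma ncD4 (x y z w : C) : nc (x + y + z + w) <= nc x + nc y + nc z + nc w.
Proof.
apply: (le_trans (ncD _ _)); rewrite lerD2r.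
by apply: (le_trans (ncD _ _)); rewrite lerD2r; exact: ncD.
Qed.

(** One step of Goursat's bisection: among the four triangles cut out by the
    midlines, one carries at least a quarter of the integral. *)
Lemma tri_int_child S phi a b c D : seg_convex S ->
  (forall z, S z -> continuous_nc phi z) -> S a -> S b -> S c ->
  tri_size_le a b c D ->
  exists t : C * C * C, [/\ [/\ S t.1.1, S t.1.2 & S t.2],
    tri_size_le t.1.1 t.1.2 t.2 (D / 2), nc (t.1.1 - a) <= D / 2 &
    nc (tri_int phi a b c) <= 4 * nc (tri_int phi t.1.1 t.1.2 t.2)].
Proof.
move=> cS cphi Sa Sb Sc [Dab Dbc Dca].
have Sab : S (mid a b) by apply: (cS a b) => //; exact: segm_mid.
have Sbc : S (mid b c) by apply: (cS b c) => //; exact: segm_mid.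
have Sca : S (mid c a) by apply: (cS c a) => //; exact: segm_mid.
have := tri_int_subdivide cS cphi Sa Sb Sc.
set t1 := tri_int _ a (mid a b) _; set t2 := tri_int _ (mid a b) b _.
set t3 := tri_int _ (mid c a) _ c; set t4 := tri_int _ (mid a b) (mid b c) _ => E.
have D0 : 0 <= D by apply: le_trans Dab; exact: nc_ge0.
have D20 : 0 <= D / 2 by rewrite divr_ge0.
have Haab : nc (mid a b - a) <= D / 2 by rewrite mid_subl; exact: nc_halfle.
have Haca : nc (mid c a - a) <= D / 2.
  by rewrite nc_sym mid_subr; exact: nc_halfle.
have sum4 : nc (tri_int phi a b c) <= nc t1 + nc t2 + nc t3 + nc t4.
  rewrite E; exact: ncD4.
have half (x y : C) (d : C) : nc d <= D -> x - y = d / 2 \/ y - x = d / 2 ->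
    nc (x - y) <= D / 2.
  by move=> hd [->|h]; rewrite ?(nc_sym x) ?h; exact: nc_halfle.
have [h1|h1] := leP (nc (tri_int phi a b c)) (4 * nc t1).
  exists (a, mid a b, mid c a); split => //=; last by rewrite subrr Normc.normc0.
  split; first exact: Haab; last by rewrite nc_sym.
  apply: (half _ _ _ Dbc); left; rewrite /mid; by field.
have [h2|h2] := leP (nc (tri_int phi a b c)) (4 * nc t2).
  exists (mid a b, b, mid b c); split => //=; split.
  - by apply: (half _ _ _ Dab); left; exact: mid_subr.
  - by apply: (half _ _ _ Dbc); left; exact: mid_subl.
  - by apply: (half _ _ _ Dca); left; rewrite /mid; field.
have [h3|h3] := leP (nc (tri_int phi a b c)) (4 * nc t3).
  exists (mid c a, mid b c, c); split => //=; split.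
  - by apply: (half _ _ _ Dab); left; rewrite /mid; field.
  - by apply: (half _ _ _ Dbc); left; exact: mid_subr.
  - by apply: (half _ _ _ Dca); left; exact: mid_subl.
exists (mid a b, mid b c, mid c a); split => //=; first split.
- by apply: (half _ _ _ Dca); right; rewrite /mid; field.
- by apply: (half _ _ _ Dab); right; rewrite /mid; field.
- by apply: (half _ _ _ Dbc); right; rewrite /mid; field.
- lra.
Qed.

Lemma seg_int_approx phi p q (m k : C) (D B : R) : continuous_on_segm phi p q ->
  nc (q - p) <= D -> (forall z, segm p q z -> nc (phi z - (m * z + k)) <= B) ->
  nc (seg_int phi p q - (q - p) * (m * mid p q + k)) <= D * B.
Proof.
move=> cphi hD H; rewrite /seg_int -mulrBr ncM; apply: ler_pM; rewrite ?nc_ge0 //.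
rewrite -seg_mean_affine.
have -> : seg_mean phi p q - seg_mean (fun z => m * z + k) p q =
    seg_mean (fun z => 1 * phi z + (-1) * (m * z + k)) p q - 0.
  rewrite seg_mean_linear //; first by rewrite mul1r mulN1r subr0.
  by move=> z _; exact: continuous_affine.
apply: seg_mean_bound.
  by apply: continuous_on_segm_linear => // z _; exact: continuous_affine.
by move=> z /H; rewrite mul1r mulN1r subr0.
Qed.

Lemma segm_nc_le p q z : segm p q z -> nc (z - p) <= nc (q - p).
Proof. by move=> hz; apply: segm_diam => //; exact: segm_l. Qed.

Lemma tri_edges_near a b c D z : tri_size_le a b c D ->
  segm a b z \/ segm b c z \/ segm c a z -> nc (z - a) <= 2 * D.
Proof.
move=> [Dab Dbc Dca]; have D0 : 0 <= D by apply: le_trans Dab; exact: nc_ge0.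
move=> [/segm_nc_le h|[/segm_nc_le h|/segm_sym/segm_nc_le h]].
- apply: (le_trans h); lra.
- apply: (le_trans (nc_split b _ _)); lra.
- by rewrite nc_sym in Dca; apply: (le_trans h); lra.
Qed.

(** Affine functions integrate to zero around a triangle, so near a point of
    differentiability the integral is of smaller order than the squared size. *)
Lemma tri_int_local phi a b c p (d : C) (D e : R) : 0 <= e -> tri_size_le a b c D ->
  nc (a - p) <= D ->
  continuous_on_segm phi a b -> continuous_on_segm phi b c ->
  continuous_on_segm phi c a ->
  (forall z, nc (z - p) <= 3 * D ->
     nc (phi z - phi p - d * (z - p)) <= e * nc (z - p)) ->
  nc (tri_int phi a b c) <= 9 * e * D ^+ 2.
Proof.
move=> e0 hs ap cab cbc cca H; have [Dab Dbc Dca] := hs.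
have D0 : 0 <= D by apply: le_trans Dab; exact: nc_ge0.
pose k := phi p - d * p.
have near z : segm a b z \/ segm b c z \/ segm c a z ->
    nc (phi z - (d * z + k)) <= e * (3 * D).
  move=> /(tri_edges_near hs) za.
  have zp : nc (z - p) <= 3 * D by apply: (le_trans (nc_split a _ _)); lra.
  have -> : phi z - (d * z + k) = phi z - phi p - d * (z - p).
    by rewrite /k; ring.
  by apply: (le_trans (H _ zp)); rewrite ler_wpM2l.
have h1 := seg_int_approx cab Dab (fun z hz => near z (or_introl hz)).
have h2 := seg_int_approx cbc Dbc (fun z hz => near z (or_intror (or_introl hz))).
have h3 := seg_int_approx cca Dca (fun z hz => near z (or_intror (or_intror hz))).
move: h1 h2 h3; set x1 := seg_int _ _ _ - _; set x2 := seg_int _ _ _ - _.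
set x3 := seg_int _ _ _ - _ => h1 h2 h3.
have -> : tri_int phi a b c = x1 + x2 + x3.
  by rewrite /x1 /x2 /x3 /tri_int /mid; field.
have -> : 9 * e * D ^+ 2 = D * (e * (3 * D)) + D * (e * (3 * D)) + D * (e * (3 * D)).
  by ring.
apply: (le_trans (ncD _ _)); apply: lerD => //.
by apply: (le_trans (ncD _ _)); exact: lerD.
Qed.

(** Bisection gives nested triangles of size [D / 2 ^ n] with integral at least
    [I / 4 ^ n], shrinking to a point of [S]; [tri_int_local] at that point
    forces [I = 0]. *)
Lemma goursat S phi a b c : seg_convex S -> closed S ->
  (forall z, S z -> exists d, has_cderiv phi z d) -> S a -> S b -> S c ->
  tri_int phi a b c = 0.
Proof.
move=> cS clS dphi Sa Sb Sc.
have cphi z : S z -> continuous_nc phi z.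
  by move=> /dphi[d]; exact: has_cderiv_continuous.
pose D := nc (b - a) + nc (c - b) + nc (a - c).
have hD : tri_size_le a b c D.
  by rewrite /D; split; have := nc_ge0 (b - a); have := nc_ge0 (c - b);
    have := nc_ge0 (a - c); lra.
have D0 : 0 <= D by case: hD => h _ _; apply: le_trans h; exact: nc_ge0.
(* A state is a triangle together with a bound on its edges. *)
pose ok (x : (C * C * C) * R) := [/\ S x.1.1.1, S x.1.1.2 & S x.1.2] /\
  tri_size_le x.1.1.1 x.1.1.2 x.1.2 x.2.
pose I (t : C * C * C) := nc (tri_int phi t.1.1 t.1.2 t.2).
have /choice[f Hf] (x : (C * C * C) * R) : exists y : C * C * C, ok x ->
    [/\ ok (y, x.2 / 2), nc (y.1.1 - x.1.1.1) <= x.2 / 2 & I x.1 <= 4 * I y].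
  have [okx|nok] := pselect (ok x); last by exists x.1.
  have [[S1 S2 S3] sx] := okx.
  have [t [St tsz ta tI]] := tri_int_child cS cphi S1 S2 S3 sx.
  by exists t => _; split.
pose u n := iter n (fun x => (f x, x.2 / 2)) ((a, b, c), D).
have u2 n : (u n).2 = D / 2 ^+ n.
  elim: n => [|n IH]; first by rewrite expr0 divr1.
  by rewrite /u iterS -/(u n) /= IH exprSr invfM mulrA.
have oku n : ok (u n).
  by elim: n => [//|n /Hf[]]; rewrite /u iterS.
have uI n : I (a, b, c) <= 4 ^+ n * I (u n).1.
  elim: n => [|n IH]; first by rewrite expr0 mul1r.
  apply: (le_trans IH); rewrite exprSr -mulrA ler_wpM2l ?exprn_ge0 //.
  by have [_ _] := Hf _ (oku n); rewrite [in u n.+1]/u iterS -/(u n).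
pose v n := (u n).1.1.1.
have vS n k : nc (v (n + k)%N - v n) <= D / 2 ^+ n - D / 2 ^+ (n + k).
  elim: k => [|k IH]; first by rewrite addn0 !subrr Normc.normc0.
  apply: (le_trans (nc_split (v (n + k)%N) _ _)).
  have [_ h _] := Hf _ (oku (n + k)%N).
  have h' : nc (v (n + k.+1)%N - v (n + k)%N) <= D / 2 ^+ (n + k) / 2.
    by rewrite -u2 addnS {1}/v [in u _.+1]/u iterS -/(u _).
  have -> : D / 2 ^+ (n + k.+1) = D / 2 ^+ (n + k) / 2.
    by rewrite addnS exprSr invfM mulrA.
  lra.
have vle n m : (n <= m)%N -> nc (v m - v n) <= D / 2 ^+ n.
  move=> /subnKC <-; apply: (le_trans (vS _ _)).
  by rewrite lerBlDr lerDl divr_ge0 // exprn_ge0.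
have small (e : R) : 0 < e -> exists N, D / 2 ^+ N < e.
  move=> e0; have Le : 0 < e / (1 + D) by rewrite divr_gt0 // ltr_pwDl.
  have [N _ /(_ N (leqnn N)) /= hN] := near_infty_natSinv_expn_lt (PosNum Le).
  exists N; move: hN; rewrite div1r ltr_pdivlMr ?ltr_pwDl // mulrC.
  by apply: le_lt_trans; rewrite ler_wpM2r ?invr_ge0 ?exprn_ge0 // lerDr.
have /cvg_ex[p /cvg_ncP vp] : cvg (v @ \oo).
  apply: cauchy_nc_cvg => e /small[N hN]; exists N => n /vle h.
  exact: le_lt_trans hN.
have vp' n : nc (v n - p) <= D / 2 ^+ n.
  apply/ler_addgt0Pl => e /vp[N HN].
  apply: (le_trans (nc_split (v (maxn n N)) _ _)); rewrite addrC; apply: lerD.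
    by apply: ltW; apply: HN; exact: leq_maxr.
  by rewrite nc_sym; apply: vle; exact: leq_maxl.
have Sp : S p.
  move/closure_id: clS => ->; apply/closure_ncP => r /vp[N /(_ N (leqnn N)) h].
  by exists (v N) => //; have [[]] := oku N.
have [d hd] := dphi p Sp.
apply/eqP; rewrite -nc_eq0 eq_le nc_ge0 andbT.
have K0 : 0 < 9 * D ^+ 2 + 1 by rewrite ltr_wpDl // mulr_ge0 // sqr_ge0.
apply/ler_addgt0Pl => e e0; rewrite addr0.
have e'0 : 0 < e / (9 * D ^+ 2 + 1) by rewrite divr_gt0.
have [r r0 Hr] := hd _ e'0.
have r30 : 0 < r / 3 by rewrite divr_gt0.
have [N hN] := small _ r30.
have [[SN1 SN2 SN3]] := oku N; rewrite u2 => szN.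
have cc q1 q2 : S q1 -> S q2 -> continuous_on_segm phi q1 q2.
  by move=> h1 h2 z hz; apply: cphi; exact: cS hz.
have r3 : 3 * (D / 2 ^+ N) < r by move: hN; rewrite ltr_pdivlMr // mulrC.
have hloc := tri_int_local (ltW e'0) szN (vp' N) (cc _ _ SN1 SN2) (cc _ _ SN2 SN3)
  (cc _ _ SN3 SN1) (fun z hz => Hr z (le_lt_trans hz r3)).
apply: (le_trans (uI N)).
apply: (@le_trans _ _ (4 ^+ N * (9 * (e / (9 * D ^+ 2 + 1)) * (D / 2 ^+ N) ^+ 2))).
  by rewrite ler_wpM2l ?exprn_ge0.
have -> : 4 ^+ N = (2 ^+ N) ^+ 2 :> R by rewrite exprAC; congr (_ ^+ _); ring.
have h2N : (2 : R) ^+ N != 0 by rewrite expf_neq0.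
have -> : (2 ^+ N) ^+ 2 * (9 * (e / (9 * D ^+ 2 + 1)) * (D / 2 ^+ N) ^+ 2) =
  e * ((9 * D ^+ 2) / (9 * D ^+ 2 + 1)).
  by field; rewrite h2N andbT gt_eqF.
rewrite ler_piMr ?(ltW e0) // ler_pdivrMr // mul1r; lra.
Qed.

End Goursat.

(** * Goursat's theorem with an exceptional vertex *)

Section CauchySquare.
Context {R : realType}.
Local Notation C := (Cplx R).
Implicit Types (z w p q a b c x y : C) (f phi psi : C -> C) (S : set C).

Lemma continuous_ncP phi z : continuous_nc phi z <-> {for z, continuous phi}.
Proof.
split=> [H|/cvgrPdist_lt H].
  apply/(@cvgrPdist_lt _ _ _ _ (nbhs_filter z)) => e e0; have [e0' ee] := complex_gt0E e0.
  apply/nbhs_ncP; have [r r0 Hr] := H _ e0'; exists r => // u /Hr h.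
  by rewrite normcE_complex ee ltcR nc_sym.
move=> e e0; have := H e%:C%C; rewrite ltcR => /(_ e0)/nbhs_ncP[r r0 Hr].
by exists r => // u /Hr; rewrite normcE_complex ltcR nc_sym.
Qed.

Lemma continuous_ncM phi psi z : continuous_nc phi z -> continuous_nc psi z ->
  continuous_nc (fun u => phi u * psi u) z.
Proof.
move=> /continuous_ncP h1 /continuous_ncP h2; apply/continuous_ncP.
exact: (@continuousM _ C phi psi z h1 h2).
Qed.

Lemma continuous_nc_pole x z : z != x -> continuous_nc (fun u => (u - x)^-1) z.
Proof.
move=> zx.
have d1 := derivableB (@derivable_id _ C z 1) (@derivable_cst _ C C x z 1).
have ne : (id - cst x) z != 0 by rewrite /= subr_eq0.
have /derivable_has_cderiv[d] := derivableV ne d1.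
exact: has_cderiv_continuous.
Qed.

Lemma continuous_nc_cst (k z : C) : continuous_nc (fun=> k) z.
Proof. by move=> e e0; exists 1 => // u _; rewrite subrr Normc.normc0. Qed.

Lemma has_cderiv_near phi psi z d : (\forall u \near z, phi u = psi u) ->
  has_cderiv phi z d -> has_cderiv psi z d.
Proof.
move=> /nbhs_ncP[r r0 Hr] H e e0; have [r' r'0 Hr'] := H e e0.
exists (Num.min r r'); first by rewrite lt_min r0.
move=> u; rewrite lt_min => /andP[ur ur'].
by rewrite -!Hr ?subrr ?Normc.normc0 //; exact: Hr'.
Qed.

Lemma derivable_slope f k a z : derivable f z 1 -> z != a ->
  derivable (fun u => (f u - k) / (u - a) : C) z 1.
Proof.
move=> df za.
have d1 : derivable (f - cst k) z 1 by exact: derivableB df (derivable_cst k z 1).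
have d2 := derivableB (@derivable_id _ C z 1) (@derivable_cst _ C C a z 1).
have ne : (id - cst a) z != 0 by rewrite /= subr_eq0.
have d3 := derivableV ne d2.
have d4 := derivableM d1 d3.
exact: d4.
Qed.

Lemma segm_subset_convex S (l : C -> R) (m : R) :
  seg_convex S ->
  (forall p q (t : R), l (p + t%:C%C * (q - p)) = l p + t * (l q - l p)) ->
  seg_convex [set z | S z /\ m <= l z].
Proof.
move=> cS lin p q [Sp mp] [Sq mq] z hz; split; first exact: cS hz.
case: hz => t /= /andP[t0 t1] <-; rewrite lin.
have -> : l p + t * (l q - l p) = (1 - t) * l p + t * l q by ring.
have -> : m = (1 - t) * m + t * m by ring.
by apply: lerD; apply: ler_wpM2l => //; rewrite subr_ge0.
Qed.

(** The difference quotient of a holomorphic function is a priori only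
    continuous at the base point [a].  Cutting along the midlines leaves one
    triangle at [a] of half the size and three that lie in the half-plane
    [Re ((z - a) * nu) >= 1 / 2], which avoids [a]; so the integral equals the
    one around an arbitrarily small triangle at [a].  The condition on [nu] says
    that [b] and [c] lie strictly on one side of a line through [a]. *)
Lemma goursat_vertex S phi a b c (nu : C) : seg_convex S -> closed S ->
  (forall z, S z -> continuous_nc phi z) ->
  (forall z, S z -> z != a -> exists d, has_cderiv phi z d) ->
  S a -> S b -> S c ->
  1 <= complex.Re ((b - a) * nu) -> 1 <= complex.Re ((c - a) * nu) ->
  tri_int phi a b c = 0.
Proof.
move=> cS clS cphi dphi Sa Sb Sc hb hc.
apply/eqP; rewrite -nc_eq0 eq_le nc_ge0 andbT.
apply/ler_addgt0Pl => e e0; rewrite addr0.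
have [r r0 Hr] := cphi a Sa 1 ltr01.
pose B := nc (phi a) + 1.
have B0 : 0 < B by rewrite /B ltr_wpDl // nc_ge0.
(* A triangle whose edges at [a] are at most [L] stays within [r] of [a],
   where [phi] is bounded by [B], and has perimeter at most [4 * L]. *)
pose L := Num.min (r / 4) (e / (4 * B)).
have L0 : 0 < L by rewrite lt_min !divr_gt0 // mulr_gt0.
have [n [hbn hcn]] : exists n, nc (b - a) <= L * 2 ^+ n /\ nc (c - a) <= L * 2 ^+ n.
  pose T := (nc (b - a) + nc (c - a)) / L.
  have Tge0 : 0 <= T by rewrite /T divr_ge0 ?addr_ge0 ?nc_ge0 // ltW.
  have T0 : 0 < (T + 1)^-1 by rewrite invr_gt0 ltr_wpDl.
  have [n _ /(_ n (leqnn n)) /=] := near_infty_natSinv_expn_lt (PosNum T0).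
  rewrite div1r ltf_pV2 ?posrE ?exprn_gt0 ?ltr_wpDl // => hn.
  have : nc (b - a) + nc (c - a) <= L * 2 ^+ n.
    by rewrite mulrC -ler_pdivrMr //; apply: ltW; apply: lt_trans hn; rewrite ltrDl.
  by exists n; have := nc_ge0 (b - a); have := nc_ge0 (c - a); split; lra.
elim: n b c nu Sb Sc hb hc hbn hcn => [|n IH] b c nu Sb Sc hb hc hbn hcn.
  rewrite expr0 mulr1 in hbn hcn.
  have L4 : 4 * L <= r by rewrite mulrC -ler_pdivlMr // ge_min lexx.
  have LB : 4 * B * L <= e by rewrite mulrC -ler_pdivlMr ?mulr_gt0 // ge_min lexx orbT.
  have ball_ok p q D : S p -> S q -> nc (q - p) <= D -> nc (p - a) + D < r ->
      nc (seg_int phi p q) <= D * B.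
    move=> Sp Sq hD hr; rewrite /seg_int ncM; apply: ler_pM; rewrite ?nc_ge0 //.
    rewrite -[seg_mean _ _ _]subr0; apply: seg_mean_bound.
      by move=> z hz; apply: cphi; exact: cS hz.
    move=> z hz; rewrite subr0 -[phi z](subrK (phi a)) /B.
    apply: (le_trans (ncD _ _)); rewrite [leLHS]addrC lerD2l; apply/ltW/Hr.
    apply: le_lt_trans hr; rewrite [leRHS]addrC; apply: (le_trans (nc_split p _ _)).
    by rewrite lerD2r; apply: le_trans hD; exact: segm_nc_le.
  have hbc : nc (c - b) <= 2 * L.
    by apply: (le_trans (nc_split a _ _)); rewrite [nc (a - b)]nc_sym; lra.
  rewrite /tri_int; apply: (le_trans (ncD _ _)).
  apply: (@le_trans _ _ (L * B + 2 * L * B + L * B)); last by apply: le_trans LB; lra.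
  apply: lerD.
    apply: (le_trans (ncD _ _)); apply: lerD; apply: ball_ok => //; last by lra.
    by rewrite subrr Normc.normc0; lra.
  by rewrite seg_int_sym ncN; apply: ball_ok => //; rewrite subrr Normc.normc0; lra.
have Sab : S (mid a b) by apply: (cS a b) => //; exact: segm_mid.
have Sbc : S (mid b c) by apply: (cS b c) => //; exact: segm_mid.
have Sca : S (mid c a) by apply: (cS c a) => //; exact: segm_mid.
rewrite (tri_int_subdivide cS cphi Sa Sb Sc).
pose l z := complex.Re ((z - a) * nu).
have lin p q (t : R) : l (p + t%:C%C * (q - p)) = l p + t * (l q - l p).
  rewrite /l; case: p q nu a {hb hc dphi Sa Hr hbn hcn Sab Sbc Sca IH l B B0 L L0} =>
    [? ?] [? ?] [? ?] [? ?] /=; ring.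
(* The convex set in which the three triangles away from [a] lie. *)
pose S' := [set z | S z /\ 2^-1 <= l z].
have cS' : seg_convex S' by exact: segm_subset_convex.
have clS' : closed S'.
  move=> z clz; split.
    move/closure_id: clS => ->; apply/closure_ncP => r' r'0.
    by move/closure_ncP: clz => /(_ _ r'0)[u [Su _] uz]; exists u.
  apply/ler_addgt0Pl => e' e'0.
  have K0 : 0 < 1 + nc nu by rewrite ltr_pwDl // nc_ge0.
  move/closure_ncP: clz => /(_ (e' / (1 + nc nu)) (divr_gt0 e'0 K0))[u [_ lu]].
  rewrite ltr_pdivlMr // => uz.
  have h : `|complex.Re ((u - z) * nu)| <= e'.
    apply: (le_trans (Re_le_nc _)); rewrite ncM; apply: ltW; apply: le_lt_trans uz.
    by rewrite ler_wpM2l ?nc_ge0 // lerDr.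
  have E : complex.Re ((u - z) * nu) = l u - l z.
    rewrite /l; case: (nu) (u) (z) (a) => [? ?] [? ?] [? ?] [? ?] /=; ring.
  by move: h; rewrite E ler_norml => /andP[]; lra.
have dS' z : S' z -> exists d, has_cderiv phi z d.
  move=> [Sz lz]; apply: dphi => //; apply: contraTneq lz => ->.
  by rewrite /l subrr mul0r /= -ltNge invr_gt0.
have lmid p q : l (mid p q) = (l p + l q) / 2.
  have -> : mid p q = p + (2^-1)%:C%C * (q - p).
    by rewrite fmorphV rmorph_nat /mid; field.
  by rewrite lin; field.
have la : l a = 0 by rewrite /l subrr mul0r.
have lb : 1 <= l b by [].
have lc : 1 <= l c by [].
have S'ab : S' (mid a b) by split => //; rewrite lmid la; lra.
have S'ca : S' (mid c a) by split => //; rewrite lmid la; lra.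
have S'bc : S' (mid b c) by split => //; rewrite lmid; lra.
have S'b : S' b by split => //; lra.
have S'c : S' c by split => //; lra.
rewrite (goursat cS' clS' dS' S'ab S'b S'bc) (goursat cS' clS' dS' S'ca S'bc S'c).
rewrite (goursat cS' clS' dS' S'ab S'bc S'ca) !addr0.
have Re2 z : complex.Re (z / 2 * (2 * nu)) = complex.Re (z * nu).
  by congr complex.Re; field.
apply: (IH _ _ (2 * nu)) => //.
- by rewrite mid_subl Re2.
- have -> : mid c a - a = (c - a) / 2 by rewrite /mid; field.
  by rewrite Re2.
- by rewrite mid_subl nc_half ler_pdivrMr // -mulrA -exprSr.
- have -> : mid c a - a = (c - a) / 2 by rewrite /mid; field.
  by rewrite nc_half ler_pdivrMr // -mulrA -exprSr.
Qed.

End CauchySquare.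

(** * The Cauchy formula on a square *)

Section Square.
Context {R : realType}.
Local Notation C := (Cplx R).
Variables (z0 : C) (s : R).
Hypothesis s_gt0 : 0 < s.
Implicit Types (z w p q a b c x y : C) (f phi psi : C -> C) (k : nat).

Local Notation I := ('i%C : C).

(** The factor [1 - 'i] places the corners so that side [k] is the segment at
    distance [s] from [z0] in the direction ['i ^+ k]. *)
Definition corner k : C := z0 + s%:C%C * (1 - I) * I ^+ k.

Definition square_boundary : set C :=
  [set z | exists2 k, (k < 4)%N & segm (corner k) (corner k.+1) z].

Definition square_int phi : C :=
  \sum_(k < 4) seg_int phi (corner k) (corner k.+1).

Definition disc (r : R) : set C := [set z | nc (z - z0) <= r].

Lemma iX2 : I ^+ 2 = -1.
Proof.
apply/eqP; rewrite expr2 eq_complex /= !mul0r !mulr0 mulr1 sub0r addr0 oppr0.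
by rewrite !eqxx.
Qed.

Lemma nc_i k : nc (I ^+ k) = 1.
Proof. by rewrite ncX /= expr0n /= add0r expr1n sqrtr1 expr1n. Qed.

Lemma corner4 : corner 4 = corner 0.
Proof. by rewrite /corner (exprM I 2 2) iX2 sqrrN expr1n. Qed.

Lemma side_param k z : segm (corner k) (corner k.+1) z ->
  exists2 t : R, `|t| <= 1 & z - z0 = s%:C%C * I ^+ k * (1 + t%:C%C * I).
Proof.
move=> [t /= /andP[t0 t1] <-]; exists (2 * t - 1).
  by rewrite ler_norml; apply/andP; split; lra.
rewrite /corner exprS rmorphB rmorphM rmorph1 rmorph_nat.
have -> : (z0 + s%:C%C * (1 - I) * I ^+ k + t%:C%C * (z0 + s%:C%C * (1 - I) *
  (I * I ^+ k) - (z0 + s%:C%C * (1 - I) * I ^+ k)) - z0 : C) =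
  s%:C%C * I ^+ k * ((1 - I) + t%:C%C * (1 - I) * (I - 1)) by ring.
have -> : (1 - I) + t%:C%C * (1 - I) * (I - 1) =
  1 - I + t%:C%C * (2 * I - 1 - I ^+ 2) by ring.
by rewrite iX2; ring.
Qed.

Lemma side_diff k : corner k.+1 - corner k = 2 * s%:C%C * I ^+ k * I.
Proof.
rewrite /corner exprS.
have -> : z0 + s%:C%C * (1 - I) * (I * I ^+ k) - (z0 + s%:C%C * (1 - I) * I ^+ k)
  = s%:C%C * I ^+ k * (2 * I - 1 - I ^+ 2) by ring.
by rewrite iX2; ring.
Qed.

Lemma side_length k : nc (corner k.+1 - corner k) = 2 * s.
Proof.
rewrite side_diff !ncM nc_i nc_nat nc_real gtr0_norm // mulr1.
by have := nc_i 1; rewrite expr1 => ->; rewrite mulr1.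
Qed.

Lemma square_boundary_far z : square_boundary z -> s <= nc (z - z0).
Proof.
move=> [k _ /side_param[t _ ->]]; rewrite !ncM nc_i nc_real gtr0_norm // mulr1.
rewrite ler_pMr //; apply: le_trans (Re_le_nc _).
by rewrite /= mulr0 mul0r subr0 addr0 normr1.
Qed.

Lemma square_boundary_away z x : square_boundary z -> nc (x - z0) <= s / 2 ->
  s / 2 <= nc (z - x).
Proof.
move=> /square_boundary_far hz hx; have := nc_split x z z0.
by have := s_gt0; lra.
Qed.

Lemma square_boundary_neq z x : square_boundary z -> nc (x - z0) <= s / 2 -> z != x.
Proof.
move=> hz hx; have := square_boundary_away hz hx; apply: contraTneq => ->.
by rewrite subrr Normc.normc0 -ltNge divr_gt0.
Qed.

Lemma square_boundary_disc : square_boundary `<=` disc (2 * s).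
Proof.
move=> z [k _ /side_param[t t1 zE]]; rewrite /disc /= zE !ncM nc_i nc_real gtr0_norm //.
rewrite mulr1 mulrC ler_pM2r //; apply: (le_trans (ncD _ _)).
have := nc_i 1; rewrite expr1 ncM => ->; rewrite nc_real Normc.normc1 mulr1; lra.
Qed.

Lemma corner_boundary k : (k < 4)%N -> square_boundary (corner k).
Proof. by move=> k4; exists k => //; exact: segm_l. Qed.

Lemma disc_convex (r : R) : seg_convex (disc r).
Proof.
move=> p q hp hq _ [t /= /andP[t0 t1] <-]; rewrite /disc /=.
have -> : p + t%:C%C * (q - p) - z0 =
    (1 - t)%:C%C * (p - z0) + t%:C%C * (q - z0).
  by rewrite rmorphB rmorph1; ring.
apply: (le_trans (ncD _ _)); rewrite !ncM !nc_real !ger0_norm ?subr_ge0 //.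
have -> : r = (1 - t) * r + t * r by ring.
by apply: lerD; apply: ler_wpM2l => //; rewrite subr_ge0.
Qed.

Lemma disc_closed (r : R) : closed (disc r).
Proof.
move=> z /closure_ncP H; rewrite /disc /=; apply/ler_addgt0Pl => e /H[u hu uz].
by apply: (le_trans (nc_split u _ _)); rewrite nc_sym; apply: lerD => //; apply: ltW.
Qed.

Definition continuous_on_boundary phi :=
  forall z, square_boundary z -> continuous_nc phi z.

Lemma continuous_on_side phi k : continuous_on_boundary phi -> (k < 4)%N ->
  continuous_on_segm phi (corner k) (corner k.+1).
Proof. by move=> H k4 z hz; apply: H; exists k. Qed.

Lemma square_int_linear phi psi (a b : C) :
  continuous_on_boundary phi -> continuous_on_boundary psi ->
  square_int (fun z => a * phi z + b * psi z) =
  a * square_int phi + b * square_int psi.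
Proof.
move=> c1 c2; rewrite /square_int !mulr_sumr -big_split /=.
apply: eq_bigr => k _; rewrite /seg_int seg_mean_linear; first by ring.
- exact: continuous_on_side.
- exact: continuous_on_side.
Qed.

Lemma square_int_ext phi psi : (forall z, square_boundary z -> phi z = psi z) ->
  square_int phi = square_int psi.
Proof.
move=> H; apply: eq_bigr => k _; congr (_ * _).
by apply: seg_mean_ext => z hz; apply: H; exists k.
Qed.

Lemma square_int_bound phi (B : R) : continuous_on_boundary phi ->
  (forall z, square_boundary z -> nc (phi z) <= B) ->
  nc (square_int phi) <= 8 * s * B.
Proof.
move=> cphi H; have side k : (k < 4)%N ->
    nc (seg_int phi (corner k) (corner k.+1)) <= 2 * s * B.
  move=> k4; rewrite /seg_int ncM side_length ler_wpM2l //.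
    by rewrite mulr_ge0 // ltW.
  rewrite -[seg_mean _ _ _]subr0; apply: seg_mean_bound.
    exact: continuous_on_side.
  by move=> z hz; rewrite subr0; apply: H; exists k.
have -> : 8 * s * B = 2 * s * B + 2 * s * B + 2 * s * B + 2 * s * B by ring.
rewrite /square_int !big_ord_recr big_ord0 /= add0r.
apply: (le_trans (ncD4 _ _ _ _)).
by do !apply: lerD; exact: side.
Qed.

(** Cutting the square into the four triangles with apex [a]: the sides issuing
    from [a] cancel. *)
Lemma square_int_vertex phi a : nc (a - z0) <= s / 2 ->
  (forall z, disc (2 * s) z -> continuous_nc phi z) ->
  (forall z, disc (2 * s) z -> z != a -> exists d, has_cderiv phi z d) ->
  square_int phi = 0.
Proof.
move=> ha cphi dphi.
have Da : disc (2 * s) a by apply: (le_trans ha); have := s_gt0; lra.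
have Dc k : (k <= 4)%N -> disc (2 * s) (corner k).
  rewrite leq_eqVlt => /orP[/eqP ->|k4].
    by rewrite corner4; apply: square_boundary_disc; exact: corner_boundary.
  by apply: square_boundary_disc; exact: corner_boundary.
pose F k := seg_int phi a (corner k).
have tri0 k : (k < 4)%N -> tri_int phi a (corner k) (corner k.+1) = 0.
  move=> k4; have ik0 : I ^+ k != 0 by rewrite -nc_eq0 nc_i oner_neq0.
  have s0 : (s%:C%C : C) != 0 by rewrite -nc_eq0 nc_real normr_eq0 gt_eqF.
  have near (w : C) : w = 1 - I \/ w = 1 + I ->
      1 <= complex.Re ((z0 + s%:C%C * w * I ^+ k - a) * (2 * s%:C%C^-1 * (I ^+ k)^-1)).
    move=> hw; have -> : (z0 + s%:C%C * w * I ^+ k - a) * (2 * s%:C%C^-1 * (I ^+ k)^-1) =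
      2 * w - 2 * ((a - z0) * s%:C%C^-1 * (I ^+ k)^-1) by field; rewrite ik0 s0.
    set v := (a - z0) * _ * _.
    have hv : nc v <= 2^-1.
      rewrite /v !ncM !ncV nc_i invr1 mulr1 nc_real gtr0_norm //.
      by rewrite ler_pdivrMr // mulrC.
    have := le_trans (Re_le_nc _) hv; rewrite ler_norml; case: (v) => v1 v2 /= /andP[_].
    by case: hw => -> /=; lra.
  apply: (@goursat_vertex _ (disc (2 * s)) _ _ _ _ (2 * s%:C%C^-1 * (I ^+ k)^-1)) => //.
  - exact: disc_convex.
  - exact: disc_closed.
  - by apply: Dc; exact: ltnW.
  - exact: Dc.
  - by apply: near; left.
  - rewrite /corner exprS.
    have -> : s%:C%C * (1 - I) * (I * I ^+ k) = s%:C%C * (I - I ^+ 2) * I ^+ k.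
      by ring.
    by apply: near; right; rewrite iX2; ring.
have edge k : (k < 4)%N -> seg_int phi (corner k) (corner k.+1) = F k.+1 - F k.
  move=> /tri0; rewrite /tri_int (seg_int_sym _ a) -/(F k) -/(F k.+1) => /eqP.
  by rewrite subr_eq0 => /eqP <-; rewrite addrC addKr.
rewrite /square_int !big_ord_recr big_ord0 /= add0r !edge //.
rewrite /F corner4; ring.
Qed.

Definition cauchy_int psi x : C := square_int (fun z => psi z / (z - x)).

Lemma continuous_cauchy_kernel psi x : continuous_on_boundary psi ->
  nc (x - z0) <= s / 2 -> continuous_on_boundary (fun z => psi z / (z - x)).
Proof.
move=> cpsi hx z hz; apply: continuous_ncM; first exact: cpsi.
by apply: continuous_nc_pole; exact: square_boundary_neq.
Qed.

(** The difference quotient of [f] at [a] satisfies [square_int_vertex]; on the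
    boundary it splits into the two Cauchy kernels. *)
Lemma cauchy_formula f a : nc (a - z0) <= s / 2 ->
  (forall z, disc (2 * s) z -> derivable f z 1) ->
  cauchy_int f a = f a * cauchy_int (fun=> 1) a.
Proof.
move=> ha df.
have Da : disc (2 * s) a by apply: (le_trans ha); have := s_gt0; lra.
have [d hd] := derivable_has_cderiv (df a Da).
pose phi z := if z == a then d else (f z - f a) / (z - a).
have dphi z : disc (2 * s) z -> z != a -> exists d', has_cderiv phi z d'.
  move=> Dz za.
  have [d' h] := derivable_has_cderiv (@derivable_slope _ f (f a) a z (df z Dz) za).
  exists d'; apply: has_cderiv_near h; apply/nbhs_ncP.
  exists (nc (z - a)); first by rewrite nc_gt0 subr_eq0.
  move=> u hu; rewrite /phi ifN //; apply: contraTneq hu => ->.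
  by rewrite nc_sym ltxx.
have cphi z : disc (2 * s) z -> continuous_nc phi z.
  move=> Dz; have [->|za] := eqVneq z a; last first.
    by have [d' h] := dphi z Dz za; exact: has_cderiv_continuous h.
  move=> e e0; have e20 : 0 < e / 2 by rewrite divr_gt0.
  have [r r0 Hr] := hd _ e20; exists r => // u hu.
  rewrite {2}/phi eqxx /phi; case: eqP => [_|/eqP ua].
    by rewrite subrr Normc.normc0.
  have ua0 : u - a != 0 by rewrite subr_eq0.
  have -> : (f u - f a) / (u - a) - d = (f u - f a - d * (u - a)) / (u - a).
    by rewrite [in RHS]mulrBl mulfK.
  rewrite ncM ncV ltr_pdivrMr ?nc_gt0 //; apply: (le_lt_trans (Hr _ hu)).
  rewrite ltr_pM2r ?nc_gt0 //; lra.
have := square_int_vertex ha cphi dphi.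
have cf : continuous_on_boundary f.
  move=> z /square_boundary_disc/df/derivable_has_cderiv[d' h].
  exact: has_cderiv_continuous h.
have -> : square_int phi =
    square_int (fun z => 1 * (f z / (z - a)) + (- f a) * (1 / (z - a))).
  apply: square_int_ext => z hz; rewrite /phi ifN; last exact: square_boundary_neq.
  by rewrite mul1r mulNr mulrA mulr1 mulrBl.
rewrite square_int_linear.
- by rewrite mul1r mulNr => /eqP; rewrite subr_eq0 => /eqP.
- exact: continuous_cauchy_kernel.
- by apply: continuous_cauchy_kernel => // z _; exact: continuous_nc_cst.
Qed.

(** Difference quotients of Cauchy integrals are again Cauchy integrals, with
    the density divided by [z - y].  All regularity below comes from iterating
    this identity. *)
Lemma cauchy_int_diff psi x y : continuous_on_boundary psi ->
  nc (x - z0) <= s / 2 -> nc (y - z0) <= s / 2 ->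
  cauchy_int psi x - cauchy_int psi y =
  (x - y) * cauchy_int (fun z => psi z / (z - y)) x.
Proof.
move=> cpsi hx hy; have cx := continuous_cauchy_kernel cpsi hx.
have cy := continuous_cauchy_kernel cpsi hy.
have := square_int_linear 1 (-1) cx cy.
rewrite mul1r mulN1r -/(cauchy_int psi x) -/(cauchy_int psi y) => <-.
transitivity (square_int (fun z => (x - y) * (psi z / (z - y) / (z - x))
  + 0 * psi z)).
  apply: square_int_ext => z hz; rewrite mul0r addr0.
  have zx : z - x != 0 by rewrite subr_eq0; exact: square_boundary_neq.
  have zy : z - y != 0 by rewrite subr_eq0; exact: square_boundary_neq.
  by field; rewrite zx zy.
rewrite square_int_linear //; first by rewrite mul0r addr0.
exact: continuous_cauchy_kernel.
Qed.

Lemma cauchy_kernel_bound psi x (B : R) z :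
  nc (psi z) <= B -> square_boundary z -> nc (x - z0) <= s / 2 ->
  nc (psi z / (z - x)) <= B * (2 / s).
Proof.
move=> hB hz hx; rewrite ncM ncV; apply: ler_pM; rewrite ?nc_ge0 ?invr_ge0 ?nc_ge0 //.
have -> : 2 / s = (s / 2)^-1 by rewrite invf_div.
rewrite lef_pV2 ?posrE; first exact: square_boundary_away.
  by rewrite nc_gt0 subr_eq0; exact: square_boundary_neq.
by rewrite divr_gt0.
Qed.

Lemma cauchy_int_bound psi x (B : R) : continuous_on_boundary psi ->
  (forall z, square_boundary z -> nc (psi z) <= B) -> nc (x - z0) <= s / 2 ->
  nc (cauchy_int psi x) <= 16 * B.
Proof.
move=> cpsi hB hx.
have -> : 16 * B = 8 * s * (B * (2 / s)) by have := s_gt0 => s0; field; rewrite gt_eqF.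
apply: square_int_bound; first exact: continuous_cauchy_kernel.
by move=> z hz; apply: cauchy_kernel_bound => //; exact: hB.
Qed.

Lemma cauchy_int_lipschitz psi x y (B : R) : continuous_on_boundary psi ->
  (forall z, square_boundary z -> nc (psi z) <= B) ->
  nc (x - z0) <= s / 2 -> nc (y - z0) <= s / 2 ->
  nc (cauchy_int psi x - cauchy_int psi y) <= 16 * (B * (2 / s)) * nc (x - y).
Proof.
move=> cpsi hB hx hy; rewrite cauchy_int_diff // ncM mulrC ler_wpM2r ?nc_ge0 //.
apply: cauchy_int_bound => //; first exact: continuous_cauchy_kernel.
by move=> z hz; apply: cauchy_kernel_bound => //; exact: hB.
Qed.

Lemma cauchy_int_derivable psi x (B : R) : continuous_on_boundary psi ->
  (forall z, square_boundary z -> nc (psi z) <= B) ->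
  nc (x - z0) < s / 2 -> derivable (cauchy_int psi) x 1.
Proof.
move=> cpsi hB hx; have hx' := ltW hx.
pose psi1 z := psi z / (z - x).
have c1 : continuous_on_boundary psi1 by exact: continuous_cauchy_kernel.
have B1 z : square_boundary z -> nc (psi1 z) <= B * (2 / s).
  by move=> hz; apply: cauchy_kernel_bound => //; exact: hB.
apply: (@has_cderiv_derivable _ _ _ (cauchy_int psi1 x)) => e e0.
pose K := 16 * (B * (2 / s) * (2 / s)).
have K0 : 0 < 1 + `|K| by rewrite ltr_pwDl.
exists (Num.min (s / 2 - nc (x - z0)) (e / (1 + `|K|))).
  by rewrite lt_min subr_gt0 hx divr_gt0.
move=> u; rewrite lt_min => /andP[u1 u2].
have hu : nc (u - z0) <= s / 2 by have := nc_split x u z0; lra.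
rewrite cauchy_int_diff // -/psi1.
have -> : (u - x) * cauchy_int psi1 u - cauchy_int psi1 x * (u - x) =
  (u - x) * (cauchy_int psi1 u - cauchy_int psi1 x) by ring.
rewrite ncM mulrC ler_wpM2r ?nc_ge0 //.
apply: (le_trans (cauchy_int_lipschitz c1 B1 hu hx')); rewrite -/K.
apply: (@le_trans _ _ ((1 + `|K|) * nc (u - x))).
  by rewrite ler_wpM2r ?nc_ge0 // (le_trans (ler_norm _)) // lerDr.
by rewrite mulrC -ler_pdivlMr //; exact: ltW.
Qed.

(** Each side contributes to the imaginary part the mean of [2 / (1 + t ^ 2)] over
    [-1 <= t <= 1], which is at least [1].  The Cauchy formula is used after
    division by this integral, so its nonvanishing is what counts. *)
Lemma cauchy_int1_far : 4 <= nc (cauchy_int (fun=> 1) z0).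
Proof.
have c1 : continuous_on_boundary (fun z => 1 / (z - z0)).
  apply: continuous_cauchy_kernel; first by move=> z _; exact: continuous_nc_cst.
  by rewrite subrr Normc.normc0 divr_ge0 // ltW.
suff h : 4 <= complex.Re (- I * cauchy_int (fun=> 1) z0).
  apply: (le_trans h); apply: (le_trans (ler_norm _)); apply: (le_trans (Re_le_nc _)).
  by rewrite ncM ncN; have := nc_i 1; rewrite expr1 => ->; rewrite mul1r.
have side k : (k < 4)%N -> 1 <= complex.Re (- I * seg_int (fun z => 1 / (z - z0))
    (corner k) (corner k.+1)).
  move=> k4; rewrite /seg_int side_diff mulrA.
  set m := - I * _.
  have cs := continuous_on_side c1 k4.
  have cz : continuous_on_segm (fun=> 0 : C) (corner k) (corner k.+1).
    by move=> z _; exact: continuous_nc_cst.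
  have -> : m * seg_mean (fun z => 1 / (z - z0)) (corner k) (corner k.+1) =
     seg_mean (fun z => m * (1 / (z - z0)) + 0 * 0) (corner k) (corner k.+1).
    by rewrite seg_mean_linear // mul0r addr0.
  apply: seg_mean_Re_ge; first exact: continuous_on_segm_linear.
  move=> z /side_param[t t1 ->]; rewrite mul0r addr0 mul1r /m.
  have ik0 : I ^+ k != 0 by rewrite -nc_eq0 nc_i oner_neq0.
  have s0 : (s%:C%C : C) != 0 by rewrite -nc_eq0 nc_real normr_eq0 gt_eqF.
  have t20 : 1 + t ^+ 2 != 0 :> R by rewrite gt_eqF // ltr_pwDl // sqr_ge0.
  have p0 : 1 + t%:C%C * I != 0 :> C.
    by rewrite eq_complex /= mul0r mulr0 subr0 addr0 oner_eq0.
  (* The integrand is [2 / (1 + 'i t) = 2 * (1 - 'i t) / (1 + t ^ 2)]. *)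
  have -> : - I * (2 * s%:C%C * I ^+ k * I) * (s%:C%C * I ^+ k * (1 + t%:C%C * I))^-1 =
    (- I ^+ 2) * (2 / (1 + t%:C%C * I)) by field; rewrite p0 ik0 s0.
  have -> : 2 / (1 + t%:C%C * I) = (2 / (1 + t ^+ 2))%:C%C * (1 - t%:C%C * I).
    apply: (canLR (mulfK p0)).
    have -> : (2 / (1 + t ^+ 2))%:C%C * (1 - t%:C%C * I) * (1 + t%:C%C * I) =
      (2 / (1 + t ^+ 2))%:C%C * (1 - t%:C%C ^+ 2 * I ^+ 2) :> C by ring.
    rewrite iX2 mulrN1 opprK -rmorphXn -(rmorph1 (real_complex R)) -rmorphD -rmorphM /=.
    by rewrite mulfVK // rmorph_nat.
  rewrite iX2 opprK mul1r /= !(mul0r, mulr0, subr0, addr0, mulr1, oppr0).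
  rewrite ler_pdivlMr ?mul1r; last by rewrite ltr_pwDl // sqr_ge0.
  have : t ^+ 2 <= 1.
    rewrite -[leRHS](expr1n _ 2) -[t ^+ 2]real_normK ?num_real //.
    by rewrite lerXn2r ?nnegrE.
  lra.
rewrite /cauchy_int /square_int !big_ord_recr big_ord0 /= add0r !mulrDr.
have ReD (u v : C) : complex.Re (u + v) = complex.Re u + complex.Re v.
  by case: u v => ? ? [].
rewrite !ReD.
have := side 0%N isT; have := side 1%N isT; have := side 2%N isT; have := side 3%N isT.
lra.
Qed.

End Square.

(** * Difference quotients of holomorphic functions *)

Section Slope.
Context {R : realType}.
Local Notation C := (Cplx R).
Implicit Types (z w p q a b c x y : C) (f phi psi : C -> C) (G H : C -> C -> C).

Definition joint_limit G p (l : C) := forall e : R, 0 < e ->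
  exists2 r : R, 0 < r & forall x y, nc (x - p) < r -> nc (y - p) < r ->
    nc (G x y - l) < e.

Lemma joint_limitP G p l : joint_limit G p l <->
  (fun u : C * C => G u.1 u.2) @ filter_prod (nbhs p) (nbhs p) --> l.
Proof.
split=> [H|/cvgrPdist_lt H e e0].
  apply/cvgrPdist_lt => e e0; have [e0' ee] := complex_gt0E e0.
  have [r r0 Hr] := H _ e0'.
  exists ([set x | nc (x - p) < r], [set x | nc (x - p) < r]) => /=.
    by split; apply/nbhs_ncP; exists r.
  by move=> [x y] /= [hx hy]; rewrite normcE_complex ee ltcR nc_sym; exact: Hr.
have := H e%:C%C; rewrite ltcR => /(_ e0)[[A B] /= [/nbhs_ncP[r1 r10 H1]
  /nbhs_ncP[r2 r20 H2]] AB].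
exists (Num.min r1 r2); first by rewrite lt_min r10.
move=> x y; rewrite !lt_min => /andP[x1 _] /andP[_ y2].
have := AB (x, y) (conj (H1 _ x1) (H2 _ y2)).
by rewrite /= normcE_complex ltcR nc_sym.
Qed.

Lemma joint_limitM G H p l m : joint_limit G p l -> joint_limit H p m ->
  joint_limit (fun x y => G x y * H x y) p (l * m).
Proof.
move=> /joint_limitP h1 /joint_limitP h2; apply/joint_limitP.
have h3 := cvgM h1 h2; exact: h3.
Qed.

Lemma joint_limitB G H p l m : joint_limit G p l -> joint_limit H p m ->
  joint_limit (fun x y => G x y - H x y) p (l - m).
Proof.
move=> lG lH e e0; have e20 : 0 < e / 2 by rewrite divr_gt0.
have [r r0 Hr] := lG _ e20; have [r' r'0 Hr'] := lH _ e20.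
exists (Num.min r r'); first by rewrite lt_min r0.
move=> x y; rewrite !lt_min => /andP[x1 x2] /andP[y1 y2].
have -> : G x y - H x y - (l - m) = (G x y - l) - (H x y - m) by ring.
apply: (le_lt_trans (ncB _ _)); rewrite [ltRHS]splitr.
by apply: ltrD; [exact: Hr|exact: Hr'].
Qed.

Lemma joint_limitV G p l : l != 0 -> joint_limit G p l ->
  joint_limit (fun x y => (G x y)^-1) p l^-1.
Proof. by move=> l0 /joint_limitP h; apply/joint_limitP; exact: cvgV. Qed.

Lemma joint_limit_lipschitz G p l (K r : R) : 0 < r ->
  (forall x y, nc (x - p) < r -> nc (y - p) < r ->
    nc (G x y - l) <= K * (nc (x - p) + nc (y - p))) -> joint_limit G p l.
Proof.
move=> r0 H e e0; have K0 : 0 < 1 + `|K| by rewrite ltr_pwDl.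
exists (Num.min r (e / (1 + `|K|) / 2)).
  by rewrite lt_min r0 !divr_gt0.
move=> x y; rewrite !lt_min => /andP[x1 x2] /andP[y1 y2].
apply: (le_lt_trans (H _ _ x1 y1)).
apply: (@le_lt_trans _ _ ((1 + `|K|) * (nc (x - p) + nc (y - p)))).
  rewrite ler_wpM2r ?addr_ge0 ?nc_ge0 //.
  by rewrite (le_trans (ler_norm _)) // lerDr.
rewrite mulrC -ltr_pdivlMr // [ltRHS]splitr; exact: ltrD.
Qed.

Lemma cauchy_int_sym p (s : R) psi x y :
  cauchy_int p s (fun z => psi z / (z - y)) x =
  cauchy_int p s (fun z => psi z / (z - x)) y.
Proof. by apply: square_int_ext => z _; rewrite mulrAC. Qed.

Lemma cauchy_int_joint_limit p (s B : R) psi : 0 < s ->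
  continuous_on_boundary p s psi ->
  (forall z, square_boundary p s z -> nc (psi z) <= B) ->
  joint_limit (fun x y => cauchy_int p s (fun z => psi z / (z - y)) x) p
    (cauchy_int p s (fun z => psi z / (z - p)) p).
Proof.
move=> s0 cpsi hB; have s20 : 0 < s / 2 by rewrite divr_gt0.
have hp : nc (p - p) <= s / 2 by rewrite subrr Normc.normc0 ltW.
apply: (@joint_limit_lipschitz _ _ _ (16 * (B * (2 / s) * (2 / s))) _ s20).
move=> x y /ltW hx /ltW hy; rewrite mulrDr.
apply: (le_trans (nc_split (cauchy_int p s (fun z => psi z / (z - y)) p) _ _)).
apply: lerD; last rewrite (cauchy_int_sym _ _ _ p y); apply: cauchy_int_lipschitz => //.
- exact: continuous_cauchy_kernel.
- by move=> z hz; exact: (@cauchy_kernel_bound _ _ _ s0 psi y B z (hB z hz) hz hy).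
- exact: continuous_cauchy_kernel.
- by move=> z hz; exact: (@cauchy_kernel_bound _ _ _ s0 psi p B z (hB z hz) hz hp).
Qed.

(** Write [H] and [J] for the Cauchy integrals of [f] and of [1], so that
    [H = f * J] by the Cauchy formula.  Then
    [J x * (f x - f y) = (H x - H y) - f y * (J x - J y)], and [cauchy_int_diff]
    divides the right-hand side by [x - y]. *)
Lemma holomorphic_slope (U : set C) f p : open U -> holomorphic_on U f -> U p ->
  exists (S : C -> C -> C) (r : R), [/\ 0 < r,
    forall x y, nc (x - p) < r -> nc (y - p) < r -> f x - f y = (x - y) * S x y,
    forall x, nc (x - p) < r -> derivable (S ^~ p) x 1 &
    joint_limit S p (S p p)].
Proof.
move=> oU hU Up; have [r0 r00 Hr0] := open_ncP oU Up.
have [d /has_cderiv_continuous cf] := derivable_has_cderiv (hU p Up).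
have [r1 r10 Hr1] := cf 1 ltr01.
(* The disc of radius [2 * s] contains the square; [f] is bounded by [B] on it. *)
pose s := Num.min r0 r1 / 4.
have s0 : 0 < s by rewrite /s divr_gt0 // lt_min r00.
have rs : 2 * s < Num.min r0 r1.
  have : 0 < Num.min r0 r1 by rewrite lt_min r00.
  by rewrite /s; lra.
move: rs; rewrite lt_min => /andP[rs0 rs1].
have df z : disc p (2 * s) z -> derivable f z 1.
  by move=> hz; apply: hU; apply: Hr0; exact: le_lt_trans rs0.
pose B := nc (f p) + 1.
have bd z : disc p (2 * s) z -> nc (f z) <= B.
  move=> hz; rewrite -[f z](subrK (f p)); apply: (le_trans (ncD _ _)).
  rewrite addrC /B lerD2l; apply/ltW/Hr1; exact: le_lt_trans rs1.
have bdf z : square_boundary p s z -> nc (f z) <= B.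
  by move=> /(square_boundary_disc s0); exact: bd.
have cbf : continuous_on_boundary p s f.
  move=> z /(square_boundary_disc s0)/df/derivable_has_cderiv[d' h].
  exact: has_cderiv_continuous h.
have cb1 : continuous_on_boundary p s (fun=> 1 : C).
  by move=> z _; exact: continuous_nc_cst.
have bd1 z : square_boundary p s z -> nc (1 : C) <= 1 by rewrite Normc.normc1.
pose r := s / 8.
have r_gt0 : 0 < r by rewrite /r divr_gt0.
have inr x : nc (x - p) < r -> nc (x - p) < s / 2 by rewrite /r; lra.
have inr' x : nc (x - p) < r -> nc (x - p) <= s / 2 by move=> /inr/ltW.
have pp : nc (p - p) < r by rewrite subrr Normc.normc0.
pose J x := cauchy_int p s (fun=> 1 : C) x.
have J0 x : nc (x - p) < r -> J x != 0.
  move=> hx; rewrite -nc_gt0.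
  have := cauchy_int_lipschitz s0 cb1 bd1 (inr' _ hx) (inr' _ pp).
  have := cauchy_int1_far p s0; rewrite -/(J p) -/(J x) => h4.
  have h : 16 * (1 * (2 / s)) * nc (x - p) < 4.
    have -> : 16 * (1 * (2 / s)) * nc (x - p) = nc (x - p) / r * 4.
      by rewrite /r; field; rewrite gt_eqF.
    by rewrite gtr_pMl // ltr_pdivrMr // mul1r.
  have := nc_split (J x) (J p) 0; rewrite !subr0 nc_sym; lra.
pose A x y := cauchy_int p s (fun z => f z / (z - y)) x.
pose Q x y := cauchy_int p s (fun z => 1 / (z - y)) x.
exists (fun x y => (A x y - f y * Q x y) / J x), r; split => //.
- move=> x y hx hy; have Jx := J0 x hx.
  have Ex := cauchy_formula s0 (inr' _ hx) df.
  have Ey := cauchy_formula s0 (inr' _ hy) df.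
  have Df := cauchy_int_diff s0 cbf (inr' _ hx) (inr' _ hy).
  have D1 := cauchy_int_diff s0 cb1 (inr' _ hx) (inr' _ hy).
  apply: (mulIf Jx); rewrite -mulrA divfK //.
  rewrite mulrBr /A -Df Ex Ey mulrCA -D1 -/(J x) -/(J y); ring.
- move=> x hx.
  have k0 psi (B' : R) : continuous_on_boundary p s psi ->
      (forall z, square_boundary p s z -> nc (psi z) <= B') ->
      derivable (cauchy_int p s (fun z => psi z / (z - p))) x 1.
    move=> cpsi hB'; apply: (@cauchy_int_derivable _ _ _ s0 _ _ (B' * (2 / s))).
    - by apply: continuous_cauchy_kernel => //; exact: inr' pp.
    - move=> z hz.
      exact: (@cauchy_kernel_bound _ _ _ s0 psi p B' z (hB' z hz) hz (inr' _ pp)).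
    - exact: inr.
  have dA := k0 f B cbf bdf.
  have dQ := k0 _ 1 cb1 bd1.
  have dJ : derivable J x 1.
    by apply: (@cauchy_int_derivable _ _ _ s0 _ _ 1) => //; exact: inr.
  have d1 := derivableM (@derivable_cst _ C C (f p) x 1) dQ.
  have d2 := derivableB dA d1.
  have d3 := derivableV (J0 x hx) dJ.
  exact: (derivableM d2 d3).
have lA := cauchy_int_joint_limit s0 cbf bdf.
have lQ := cauchy_int_joint_limit s0 cb1 bd1.
have lf : joint_limit (fun _ y => f y) p (f p).
  by move=> e /cf[r' r'0 Hr']; exists r' => // x y _; exact: Hr'.
have lJ : joint_limit (fun x _ => J x) p (J p).
  apply: (@joint_limit_lipschitz _ _ _ (16 * (1 * (2 / s))) _ r_gt0) => x y hx hy.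
  apply: (le_trans (cauchy_int_lipschitz s0 cb1 bd1 (inr' _ hx) (inr' _ pp))).
  by rewrite ler_wpM2l ?lerDl ?nc_ge0 // !mulr_ge0 // invr_ge0 ltW.
apply: joint_limitM.
  by apply: joint_limitB => //; exact: joint_limitM.
by apply: joint_limitV => //; exact: J0.
Qed.

(** An approximate linearization determines the derivative up to its relative
    error. *)
Lemma cderiv_close f z d d' (e r : R) : has_cderiv f z d' -> 0 < r ->
  (forall u, nc (u - z) < r -> nc (f u - f z - d * (u - z)) <= e * nc (u - z)) ->
  nc (d' - d) <= e.
Proof.
move=> h r0 Hr; apply/ler_addgt0Pl => e' e'0.
have [r' r'0 Hr'] := h _ e'0.
pose t := Num.min r r' / 2.
have m0 : 0 < Num.min r r' by rewrite lt_min r0.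
have t0 : 0 < t by rewrite divr_gt0.
have tm : t < Num.min r r' by rewrite /t; lra.
have uE : nc (z + t%:C%C - z) = t by rewrite addrC addKr nc_real gtr0_norm.
move: tm; rewrite -uE lt_min => /andP[/Hr h1 /Hr' h2].
have h3 : nc ((d' - d) * (z + t%:C%C - z)) <= (e' + e) * nc (z + t%:C%C - z).
  have -> : (d' - d) * (z + t%:C%C - z) =
    (f (z + t%:C%C) - f z - d * (z + t%:C%C - z)) -
    (f (z + t%:C%C) - f z - d' * (z + t%:C%C - z)) by ring.
  by apply: (le_trans (ncB _ _)); rewrite addrC mulrDl lerD.
by move: h3; rewrite ncM ler_pM2r // uE.
Qed.

Lemma has_cderiv_unique f z d d' : has_cderiv f z d -> has_cderiv f z d' -> d = d'.
Proof.
move=> h h'; apply/eqP; rewrite -subr_eq0 -nc_eq0 eq_le nc_ge0 andbT.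
apply/ler_addgt0Pl => e e0; rewrite addr0; have [r r0 Hr] := h' _ e0.
exact: (cderiv_close h r0 Hr).
Qed.

(** Strict differentiability: [d] is the value on the diagonal of the slope
    function, which is jointly continuous. *)
Lemma holomorphic_strict (U : set C) f p : open U -> holomorphic_on U f -> U p ->
  exists2 d, has_cderiv f p d & forall e : R, 0 < e ->
    exists2 r : R, 0 < r & forall x y, nc (x - p) < r -> nc (y - p) < r ->
      nc (f x - f y - d * (x - y)) <= e * nc (x - y).
Proof.
move=> oU hU Up; have [S [r [r0 HS _ lS]]] := holomorphic_slope oU hU Up.
have strict (e : R) : 0 < e ->
    exists2 r : R, 0 < r & forall x y, nc (x - p) < r -> nc (y - p) < r ->
      nc (f x - f y - S p p * (x - y)) <= e * nc (x - y).
  move=> /lS[r' r'0 Hr']; exists (Num.min r r'); first by rewrite lt_min r0.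
  move=> x y; rewrite !lt_min => /andP[x1 x2] /andP[y1 y2].
  rewrite HS // [S p p * _]mulrC -mulrBr ncM mulrC ler_wpM2r ?nc_ge0 //.
  exact/ltW/Hr'.
exists (S p p) => // e /strict[r' r'0 Hr']; exists r' => // u hu.
by apply: Hr' => //; rewrite subrr Normc.normc0.
Qed.

(** The slope function [S ^~ p] is the holomorphic cofactor of [u - p], and its
    value at [p] is the nonzero derivative. *)
Lemma vanishing_order_le1 (U : set C) f p d : open U -> holomorphic_on U f -> U p ->
  has_cderiv f p d -> d != 0 ->
  (vanishing_order (fun u => (f u - f p)%R) p <= 1%:E)%E.
Proof.
move=> oU hU Up hd d0; have [S [r [r0 HS dS lS]]] := holomorphic_slope oU hU Up.
have pp : nc (p - p) < r by rewrite subrr Normc.normc0.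
have dE : d = S p p.
  apply: (has_cderiv_unique hd) => e /lS[r' r'0 Hr'].
  exists (Num.min r r'); first by rewrite lt_min r0.
  move=> u; rewrite lt_min => /andP[u1 u2].
  rewrite HS // [S p p * _]mulrC -mulrBr ncM mulrC ler_wpM2r ?nc_ge0 //.
  by apply/ltW/Hr' => //; rewrite subrr Normc.normc0.
apply: ereal_inf_lbound; exists 1%N => //.
exists (S ^~ p); split; first by rewrite -dE.
apply/nbhs_ncP; exists r => // u hu; split; first exact: dS.
by rewrite expr1; exact: HS.
Qed.

End Slope.

(** * Expansion, contraction and the pigeonhole principle *)

Section Dynamics.
Context {R : realType}.
Local Notation C := (Cplx R).
Implicit Types (z w p q a b c x y : C) (f g : C -> C).

Lemma uniform_strict (K U : set C) g : compact K -> open U -> K `<=` U ->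
  holomorphic_on U g ->
  exists g' : C -> C, [/\ forall z, K z -> has_cderiv g z (g' z),
    exists2 L : R, 1 <= L & forall z, K z -> nc (g' z) <= L &
    forall e : R, 0 < e -> exists2 r : R, 0 < r & forall x y, K x ->
      nc (y - x) < r -> nc (g y - g x - g' x * (y - x)) <= e * nc (y - x)].
Proof.
move=> cK oU KU hU.
have /choice[g' Hg'] z : exists d, U z -> has_cderiv g z d.
  have [Uz|nUz] := pselect (U z); last by exists 0.
  by have [d hd] := derivable_has_cderiv (hU z Uz); exists d.
have local p (e : R) : K p -> 0 < e -> exists2 r : R, 0 < r &
    forall x y, nc (x - p) < r -> nc (y - p) < r ->
    nc (g' x - g' p) <= e /\ nc (g y - g x - g' x * (y - x)) <= e * nc (y - x).
  move=> /KU Up e0; have e20 : 0 < e / 2 by rewrite divr_gt0.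
  have [d hd H] := holomorphic_strict oU hU Up.
  have dE : g' p = d by apply: has_cderiv_unique hd; exact: Hg'.
  have [r r0 Hr] := H _ e20; have [r1 r10 Hr1] := open_ncP oU Up.
  exists (Num.min r r1); first by rewrite lt_min r0.
  move=> x y; rewrite !lt_min => /andP[x1 x2] /andP[y1 _].
  have close : nc (g' x - g' p) <= e / 2.
    rewrite dE; apply: (@cderiv_close _ _ _ _ _ _ (r - nc (x - p)) (Hg' x (Hr1 x x2))).
      by rewrite subr_gt0.
    by move=> u hu; apply: Hr => //; have := nc_split x u p; lra.
  split; first by apply: (le_trans close); lra.
  have -> : g y - g x - g' x * (y - x) =
    (g y - g x - d * (y - x)) - (g' x - g' p) * (y - x) by rewrite dE; ring.
  apply: (le_trans (ncB _ _)); rewrite [e in leRHS]splitr [leRHS]mulrDl; apply: lerD.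
    exact: Hr.
  by rewrite ncM ler_wpM2r ?nc_ge0.
exists g'; split.
- by move=> z /KU/Hg'.
- have [|//|r [A [r0 HA]]] := compact_uniform cK (P := fun A x _ => nc (g' x) <= A).
  + by move=> A B x _ AB /le_trans; apply.
  + move=> p Kp; have [r r0 Hr] := local p 1 Kp ltr01.
    exists r, (nc (g' p) + 1); split => // x y hx hy.
    rewrite -[g' x](subrK (g' p)); apply: (le_trans (ncD _ _)).
    by rewrite addrC lerD2l; have [] := Hr x y hx hy.
  exists (Num.max 1 A); first by rewrite le_max lexx.
  move=> z Kz; rewrite le_max; apply/orP; right.
  by apply: (HA z z) => //; rewrite subrr Normc.normc0.
- move=> e e0.
  have [|//|r [A [r0 HA]]] := compact_uniform cK
    (P := fun _ x y => nc (g y - g x - g' x * (y - x)) <= e * nc (y - x)).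
  + by [].
  + move=> p Kp; have [r r0 Hr] := local p e Kp e0.
    by exists r, 0; split => // x y hx hy; have [] := Hr x y hx hy.
  by exists r => // x y; exact: HA.
Qed.

Definition orbit_in (A : set C) g n z := forall k, (k < n)%N -> A (iter k g z).

Definition multiplier (g' : C -> C) g n z : C := \prod_(i < n) g' (iter i g z).

Section Expansion.
Variables (K : set C) (g g' : C -> C) (L : R).
Hypothesis L_ge1 : 1 <= L.
Hypothesis g'_le : forall z, K z -> nc (g' z) <= L.
Hypothesis g_strict : forall e : R, 0 < e -> exists2 r : R, 0 < r &
  forall x y, K x -> nc (y - x) < r ->
    nc (g y - g x - g' x * (y - x)) <= e * nc (y - x).

Lemma multiplier_le n z : orbit_in K g n z -> nc (multiplier g' g n z) <= L ^+ n.
Proof.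
elim: n => [|n IH] oz.
  by rewrite /multiplier big_ord0 expr0 Normc.normc1.
rewrite /multiplier big_ord_recr /= ncM exprSr; apply: ler_pM; rewrite ?nc_ge0 //.
  by apply: IH => k kn; apply: oz; exact: ltnW.
exact/g'_le/oz.
Qed.

(** The chain rule along orbits, uniformly over all starting points whose orbit
    stays in [K]; [L] controls how the errors of the single steps add up. *)
Lemma iter_strict n (e : R) : 0 < e -> exists2 r : R, 0 < r &
  forall z x, orbit_in K g n z -> nc (x - z) < r ->
    nc (iter n g x - iter n g z - multiplier g' g n z * (x - z)) <= e * nc (x - z).
Proof.
elim: n e => [|n IH] e e0.
  exists 1 => // z x _ _; rewrite /multiplier big_ord0 mul1r subrr Normc.normc0.
  by rewrite mulr_ge0 ?nc_ge0 // ltW.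
have L0 : 0 < L by exact: lt_le_trans L_ge1.
have M0 : 0 < L ^+ n + 1 by rewrite ltr_wpDl // exprn_ge0 // ltW.
have e10 : 0 < e / 2 / (L ^+ n + 1) by rewrite !divr_gt0.
have e20 : 0 < Num.min 1 (e / 2 / L) by rewrite lt_min ltr01 !divr_gt0.
have [r1 r10 H1] := g_strict e10; have [r2 r20 H2] := IH _ e20.
exists (Num.min r2 (r1 / (L ^+ n + 1))); first by rewrite lt_min r20 divr_gt0.
move=> z x oz; rewrite lt_min => /andP[x2 x1].
have oz' : orbit_in K g n z by move=> k kn; apply: oz; exact: ltnW.
have h2 := H2 z x oz' x2; have Kb := oz n (leqnn _).
have := multiplier_le oz'.
rewrite /multiplier big_ord_recr /= -/(multiplier g' g n z).
move: h2 Kb; set a' := iter n g x; set b' := iter n g z; set P := multiplier _ _ _ _.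
move=> h2 Kb hP.
have hab : nc (a' - b') <= (L ^+ n + 1) * nc (x - z).
  rewrite -[a' - b'](subrK (P * (x - z))); apply: (le_trans (ncD _ _)).
  rewrite addrC mulrDl; apply: lerD; first by rewrite ncM ler_wpM2r ?nc_ge0.
  by apply: (le_trans h2); rewrite ler_wpM2r ?nc_ge0 // ge_min lexx.
have hab1 : nc (a' - b') < r1.
  by apply: (le_lt_trans hab); rewrite mulrC -ltr_pdivlMr.
have h1 := H1 b' a' Kb hab1.
have -> : g a' - g b' - P * g' b' * (x - z) =
  (g a' - g b' - g' b' * (a' - b')) + g' b' * (a' - b' - P * (x - z)) by ring.
apply: (le_trans (ncD _ _)); rewrite [e in leRHS]splitr [leRHS]mulrDl; apply: lerD.
  apply: (le_trans h1); apply: (le_trans (ler_wpM2l (ltW e10) hab)).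
  by rewrite mulrA divfK // gt_eqF.
rewrite ncM; apply: (@le_trans _ _ (L * (e / 2 / L * nc (x - z)))).
  apply: ler_pM; rewrite ?nc_ge0 //; first exact: g'_le.
  by apply: (le_trans h2); rewrite ler_wpM2r ?nc_ge0 // ge_min lexx orbT.
by rewrite mulrA [L * _]mulrC divfK // gt_eqF.
Qed.

(** If [g x = g y] with [x] and [y] close, linearizing at [x] bounds
    [nc (g' x * (y - x))] by [e / 2 * nc (y - x)], against [e <= nc (g' x)]. *)
Lemma uniform_injectivity (e : R) : 0 < e -> exists2 delta : R, 0 < delta &
  forall x y, K x -> K y -> e <= nc (g' x) -> x <> y -> g x = g y ->
    delta < nc (x - y).
Proof.
move=> e0; have e20 : 0 < e / 2 by rewrite divr_gt0.
have [r r0 Hr] := g_strict e20; exists (r / 2); first by rewrite divr_gt0.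
move=> x y Kx Ky ge xy gxy; rewrite ltNge; apply/negP => hle.
have yx : 0 < nc (y - x) by rewrite nc_gt0 subr_eq0 eq_sym; exact/eqP.
rewrite nc_sym in hle; have yr : nc (y - x) < r by lra.
have := Hr x y Kx yr; rewrite gxy subrr sub0r ncN ncM ler_pM2r //; lra.
Qed.

End Expansion.

(** If [F] contracts [A] locally by the factor [c], then [F @` A] cannot contain
    all points of an [m.+2] by [m.+2] grid in the disc of radius [rho] around
    [p]: their preimages lie in [m.+1 ^ 2] square cells, two of them share a cell
    of side [2 * M / m], and the images of these two are closer than the mesh of
    the grid.  The mesh and the size of the cells both scale like [1 / m], hence
    the condition on [c] does not depend on [m]. *)
Lemma contraction_misses_point (F : C -> C) (A : set C) p (M c r rho : R) :
  0 < M -> 0 < r -> 0 < rho -> 0 < c -> 16 * M * c < rho ->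
  (forall z, A z -> nc z <= M) ->
  (forall z x, A z -> nc (x - z) < r -> nc (F x - F z) <= c * nc (x - z)) ->
  exists2 y, nc (y - p) < rho & forall z, A z -> F z <> y.
Proof.
move=> M0 r0 rho0 c0 small AM AF; apply: contrapT => nex.
have hit y : nc (y - p) < rho -> exists2 z, A z & F z = y.
  move=> hy; apply: contrapT => nz; apply: nex; exists y => // z Az Fz.
  by apply: nz; exists z.
(* The cells must have diameter below [r], and [m >= 2] gives [m.+2 <= 2 * m]. *)
pose m := (Num.truncn (4 * M / r)).+2.
have m0 : 0 < m%:R :> R by rewrite ltr0n.
have hm : 4 * M / m%:R < r.
  have Mr0 : 0 <= 4 * M / r by rewrite divr_ge0 ?mulr_ge0 // ltW.
  have /andP[_ h] := truncn_itv Mr0.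
  rewrite ltr_pdivrMr // [ltRHS]mulrC -ltr_pdivrMr //; apply: (lt_le_trans h).
  by rewrite ler_nat.
pose t := rho / (2 * m.+2%:R).
have t0 : 0 < t by rewrite divr_gt0 // mulr_gt0 // ltr0n.
pose grid (ij : 'I_m.+2 * 'I_m.+2) : C :=
  p + ((t * ij.1%:R) +i* (t * ij.2%:R))%C.
have grid_near ij : nc (grid ij - p) < rho.
  rewrite /grid addrC addKr; apply: (le_lt_trans (nc_le_ReIm _)) => /=.
  rewrite !ger0_norm ?(mulr_ge0 (ltW t0) (ler0n _ _)) //.
  have -> : rho = t * m.+2%:R + t * m.+2%:R.
    have := pnatr_eq0 R m.+2; rewrite /t; move: (m.+2%:R : R) => K /= K0.
    by field; rewrite K0.
  by apply: ltrD; rewrite ltr_pM2l // ltr_nat.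
have /choice[h hh] : forall ij, exists z, A z /\ F z = grid ij.
  by move=> u; have [z] := hit _ (grid_near u); exists z.
(* The upper end [u = M] falls into cell [m], hence [m.+1] cells per direction. *)
pose idx (u : R) : nat := Num.truncn ((u + M) * (m%:R / (2 * M))).
have idx_le (u : R) : `|u| <= M -> 0 <= (u + M) * (m%:R / (2 * M)) <= m%:R.
  rewrite ler_norml => /andP[u1 u2]; apply/andP; split.
    by rewrite mulr_ge0 ?divr_ge0 ?mulr_ge0 ?(ltW M0) ?ler0n //; lra.
  by rewrite mulrA ler_pdivrMr ?mulr_gt0 // mulrC ler_pM2l //; lra.
have idx_lt (u : R) : `|u| <= M -> (idx u < m.+1)%N.
  move=> /idx_le/andP[h0 h1]; rewrite ltnS /idx -(ler_nat R).
  by have /andP[h2 _] := truncn_itv h0; exact: le_trans h1.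
have idx_eq (u v : R) : `|u| <= M -> `|v| <= M -> idx u = idx v ->
    `|u - v| <= 2 * M / m%:R.
  move=> /idx_le/andP[hu _] /idx_le/andP[hv _] E.
  have /andP[u1 u2] := truncn_itv hu; have /andP[v1 v2] := truncn_itv hv.
  move: u1 u2 v1 v2; rewrite -/(idx u) -/(idx v) E -(natr1 (idx v)) => u1 u2 v1 v2.
  have K0 : 0 < m%:R / (2 * M) by rewrite divr_gt0 // mulr_gt0.
  have -> : 2 * M / m%:R = (m%:R / (2 * M))^-1 by rewrite invf_div.
  rewrite -[leRHS]mul1r ler_pdivlMr // -[m%:R / _ in leLHS]ger0_norm ?(ltW K0) //.
  rewrite -normrM mulrBl ler_norml.
  have -> : u * (m%:R / (2 * M)) - v * (m%:R / (2 * M)) =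
    (u + M) * (m%:R / (2 * M)) - (v + M) * (m%:R / (2 * M)) by ring.
  move: u1 u2 v1 v2; move: ((u + M) * _) ((v + M) * _) (_%:R) => X Y n u1 u2 v1 v2.
  by apply/andP; split; lra.
have ReM ij : `|complex.Re (h ij)| <= M.
  by have [/AM hA _] := hh ij; apply: le_trans hA; exact: Re_le_nc.
have ImM ij : `|complex.Im (h ij)| <= M.
  by have [/AM hA _] := hh ij; apply: le_trans hA; exact: Im_le_nc.
pose cell ij : 'I_m.+1 * 'I_m.+1 :=
  (Ordinal (idx_lt _ (ReM ij)), Ordinal (idx_lt _ (ImM ij))).
suff /leq_card : injective cell.
  by rewrite !card_prod !card_ord leqNgt ltn_mul.
move=> ij kl E; apply: contrapT => neq.
have := congr1 (fun c : 'I_m.+1 * 'I_m.+1 => val c.1) E.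
have := congr1 (fun c : 'I_m.+1 * 'I_m.+1 => val c.2) E.
move=> /= /(idx_eq _ _ (ImM _) (ImM _)) hI /(idx_eq _ _ (ReM _) (ReM _)) hR.
have hz : nc (h ij - h kl) <= 4 * M / m%:R.
  apply: (le_trans (nc_le_ReIm _)).
  have -> : 4 * M / m%:R = 2 * M / m%:R + 2 * M / m%:R by field; rewrite gt_eqF.
  by apply: lerD; [move: hR|move: hI]; case: (h ij) (h kl) => [? ?] [? ?].
have [Akl Fkl] := hh kl; have [_ Fij] := hh ij.
have := AF _ _ Akl (le_lt_trans hz hm); rewrite Fij Fkl => hF.
have up : nc (grid ij - grid kl) <= c * (4 * M / m%:R).
  by apply: (le_trans hF); rewrite ler_pM2l.
have low : t <= nc (grid ij - grid kl).
  have -> : grid ij - grid kl =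
    ((t * (ij.1%:R - kl.1%:R)) +i* (t * (ij.2%:R - kl.2%:R)))%C.
    by rewrite /grid opprD addrACA subrr add0r !mulrBr.
  have dist (i j : nat) : i <> j -> t <= `|t * (i%:R - j%:R)|.
    move=> ij'; rewrite normrM gtr0_norm // ler_peMr ?(ltW t0) //.
    move: ij' => /eqP; rewrite neq_ltn => /orP[] lt.
      rewrite distrC ger0_norm ?subr_ge0 ?ler_nat 1?ltnW //.
      by rewrite lerBrDr nat1r ler_nat.
    rewrite ger0_norm ?subr_ge0 ?ler_nat 1?ltnW //.
    by rewrite lerBrDr nat1r ler_nat.
  have [E1|n1] := pselect (ij.1 = kl.1 :> nat).
    apply: le_trans (Im_le_nc _); apply: dist => E2; apply: neq.
    by case: (ij) (kl) E1 E2 => [? ?] [? ?] /= /ord_inj -> /ord_inj ->.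
  by apply: le_trans (Re_le_nc _); apply: dist.
have : c * (4 * M / m%:R) < t.
  rewrite /t ltr_pdivlMr ?mulr_gt0 ?ltr0n //.
  apply: le_lt_trans small.
  have -> : c * (4 * M / m%:R) * (2 * m.+2%:R) = 8 * M * c * (m.+2%:R / m%:R).
    by field; rewrite gt_eqF.
  have -> : 16 * M * c = 8 * M * c * 2 by ring.
  rewrite ler_pM2l ?mulr_gt0 // ler_pdivrMr // -natrM ler_nat mul2n -addnn.
  by rewrite -addn2 leq_add2l.
by move=> /(le_lt_trans (le_trans low up)); rewrite ltxx.
Qed.

End Dynamics.

(** * Separated trees of preimages *)

Section Tree.
Context {R : realType}.
Local Notation C := (Cplx R).
Implicit Types (z w u : C) (g : C -> C).

Section PreimageTree.
Variables (V : set C) (g g' : C -> C) (eps delta : R) (N : nat).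
Hypothesis N_gt0 : (0 < N)%N.
Hypothesis step : forall w, V w ->
  (exists2 u, V u & g u = w /\ nc (g' u) < eps) \/
  (exists s : seq C, [/\ uniq s, size s = N &
     forall u, u \in s -> [/\ V u, g u = w & eps <= nc (g' u)]]).
Hypothesis sep : forall x y, V x -> V y -> eps <= nc (g' x) -> x <> y ->
  g x = g y -> delta < nc (x - y).

Definition good_count n z : nat := (\sum_(i < n) (eps <= nc (g' (iter i g z)))%R)%N.

Definition separated_seq n (s : seq C) := forall z z', z \in s -> z' \in s ->
  z <> z' -> exists2 k, (k < n)%N & delta < nc (iter k g z - iter k g z').

Definition tree_level n w (s : seq C) :=
  [/\ uniq s, forall z, z \in s -> orbit_in V g n.+1 z /\ iter n g z = w &
      separated_seq n s].

Lemma separated_seqS n s : separated_seq n s -> separated_seq n.+1 s.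
Proof.
move=> H z z' zs zs' zz; have [k kn kd] := H z z' zs zs' zz.
by exists k => //; exact: ltnW.
Qed.

Lemma orbit_in_last n z : orbit_in V g n.+1 z -> V (g (iter n g z)) ->
  orbit_in V g n.+2 z.
Proof.
move=> oz Vz k; rewrite ltnS leq_eqVlt => /orP[/eqP -> //|]; exact: oz.
Qed.

(** Levels over distinct good preimages of one point merge into one separated
    level: two points over different branches part at time [n]. *)
Lemma merge_levels n m w (s : seq C) : uniq s ->
  (forall u, u \in s -> [/\ V u, g u = w & eps <= nc (g' u)]) ->
  (forall u, u \in s -> exists2 t, tree_level n u t & (m <= size t)%N) ->
  exists t, [/\ uniq t, (size s * m <= size t)%N,
    forall z, z \in t -> orbit_in V g n.+1 z /\ iter n g z \in s &
    separated_seq n.+1 t].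
Proof.
move=> us; elim: s us => [|u s IH] /=.
  by move=> _ _ _; exists [::]; split.
move=> /andP[us uniqs] good sub.
have [t [ut szt ht sept]] : exists t, [/\ uniq t, (size s * m <= size t)%N,
    forall z, z \in t -> orbit_in V g n.+1 z /\ iter n g z \in s &
    separated_seq n.+1 t].
  by apply: IH => // v vs; [apply: good|apply: sub]; rewrite inE vs orbT.
have [tu [utu htu septu] sztu] := sub u (mem_head _ _).
exists (tu ++ t); split.
- rewrite cat_uniq utu ut andbT; apply/hasPn => z /ht[_ zs].
  by apply: contra us => /htu[_ <-].
- by rewrite size_cat mulSn leq_add.
- move=> z; rewrite mem_cat => /orP[/htu[oz <-]|/ht[oz zs]].
    by rewrite mem_head.
  by rewrite inE zs orbT.
have cross z z' : z \in tu -> z' \in t ->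
    delta < nc (iter n g z - iter n g z').
  move=> /htu[_ zu] /ht[_ zs]; have [Vu gu eu] := good u (mem_head _ _).
  have [] := good (iter n g z'); first by rewrite inE zs orbT.
  move=> Vz' gz' ez'; rewrite zu; apply: sep => //; last by rewrite gu gz'.
  by move=> E; move: us; rewrite E zs.
move=> z z'; rewrite !mem_cat => /orP[zt|zt] /orP[zt'|zt'] zz.
- exact: (separated_seqS septu).
- by exists n => //; exact: cross.
- by exists n => //; rewrite nc_sym; exact: cross.
- exact: sept.
Qed.

(** A step through a bad point costs nothing: the count [m] of good points still
    to come is unchanged.  A step through good points lowers it by one and
    multiplies the number of leaves by [N]. *)
Lemma preimage_tree n m w : V w ->
  (forall z, orbit_in V g n.+1 z -> iter n g z = w -> (m <= good_count n z)%N) ->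
  exists2 s, tree_level n w s & (N ^ m <= size s)%N.
Proof.
elim: n m w => [|n IH] m w Vw many.
  have : (m <= good_count 0 w)%N by apply: many => // -[].
  rewrite /good_count big_ord0 leqn0 => /eqP ->; exists [:: w] => //; split => //.
    by move=> z; rewrite inE => /eqP ->; split => // -[].
  by move=> z z'; rewrite !inE => /eqP -> /eqP ->.
have countS z : good_count n.+1 z = (good_count n z + (eps <= nc (g' (iter n g z)))%R)%N.
  by rewrite /good_count big_ord_recr.
have [[u Vu [gu du]]|[s [us szs hs]]] := step Vw.
  have [|s [us hs seps] szs] := IH m u Vu.
    move=> z oz zu; have := many z; rewrite countS zu leNgt du addn0; apply.
      by apply: orbit_in_last => //; rewrite zu gu.
    by rewrite iterS zu.
  exists s => //; split => //; last exact: separated_seqS.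
  move=> z /hs[oz zu]; rewrite iterS zu; split => //.
  by apply: orbit_in_last => //; rewrite zu gu.
have [|t [ut szt ht sept]] := merge_levels (n := n) (m := (N ^ m.-1)%N) us hs.
  move=> u /hs[Vu gu eu]; apply: IH => // z oz zu.
  have : (m <= good_count n.+1 z)%N.
    by apply: many; [apply: orbit_in_last => //; rewrite zu gu|rewrite iterS zu].
  by rewrite countS zu eu addn1; case: (m).
exists t; last first.
  apply: leq_trans szt; rewrite szs; case: (m) => [|k]; last by rewrite expnS.
  by rewrite expn0 muln1.
split => // z /ht[oz zs]; have [_ gz _] := hs _ zs; split; last by rewrite iterS.
by apply: orbit_in_last => //; rewrite gz.
Qed.

End PreimageTree.

(** Where the derivative does not vanish, every preimage counts at most once, so
    a family of fewer than [N] preimages cannot reach the total [N]. *)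
Lemma enough_preimages (V U : set C) g (g' : C -> C) N w :
  open U -> holomorphic_on U g -> V `<=` U ->
  (forall z, V z -> has_cderiv g z (g' z)) ->
  (forall u, V u -> g u = w -> g' u != 0) ->
  ((N%:R)%:E <= preimage_count V g w)%E ->
  exists s : seq C, [/\ uniq s, size s = N &
    forall u, u \in s -> V u /\ g u = w].
Proof.
move=> oU hU VU hg' simple cnt; apply: contrapT => nos.
have small (s : seq C) : uniq s -> (forall u, u \in s -> V u /\ g u = w) ->
    (size s < N)%N.
  move=> us hs; rewrite ltnNge; apply/negP => Ns; apply: nos.
  exists (take N s); split; first exact: take_uniq.
    by rewrite size_takel.
  by move=> u /mem_take/hs.
have N0 : (0 < N)%N by apply: (small [::]).
suff : (preimage_count V g w <= (N.-1%:R)%:E)%E.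
  move=> /(le_trans cnt); rewrite lee_fin ler_nat leqNgt => /negP; apply.
  by rewrite prednK.
apply: ge_ereal_sup => _ [A [finA AV] <-].
have [s us sA] : exists2 s : seq C, uniq s & A = [set` s].
  have [s ->] := (finite_seqP A).1 finA; exists (undup s); first exact: undup_uniq.
  by apply/seteqP; split => z /=; rewrite mem_undup.
have inA z : z \in s -> V z /\ g z = w.
  by move=> zs; have [|Vz gz] := AV z; [rewrite sA|split].
rewrite sA -fsbig_seq //.
apply: (@le_trans _ _ (\sum_(x <- s) 1%:E)%E).
  rewrite big_seq [leRHS]big_seq; apply: lee_sum => z /inA[Vz gz].
  rewrite -gz; apply: (vanishing_order_le1 oU hU) (hg' z Vz) _; first exact: VU.
  exact: simple.
rewrite sumEFin lee_fin big_const_seq count_predT iter_addr_0 ler_nat.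
by rewrite -ltnS prednK //; exact: small.
Qed.

End Tree.

(** * Exponential growth and entropy *)

Section Growth.
Context {R : realType}.
Local Notation C := (Cplx R).
Implicit Types (z w u : C) (g : C -> C).

Lemma good_count_le g' g (eps : R) n z : (good_count g g' eps n z <= n)%N.
Proof.
by rewrite -[leqRHS]card_ord -sum1_card; apply: leq_sum => i _; exact: leq_b1.
Qed.

Lemma multiplier_good_count (K : set C) g g' (L eps : R) n z : 1 <= L -> 0 < eps ->
  (forall z, K z -> nc (g' z) <= L) -> orbit_in K g n z ->
  nc (multiplier g' g n z) <= L ^+ n * eps ^+ (n - good_count g g' eps n z).
Proof.
move=> L1 e0 hL; have L0 : 0 <= L by apply: le_trans L1.
elim: n => [|n IH] oz.
  by rewrite /multiplier big_ord0 Normc.normc1 sub0n !expr0 mulr1.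
have {}IH := IH (fun k kn => oz k (ltnW kn)).
have hn := hL _ (oz n (leqnn _)).
rewrite /multiplier big_ord_recr /= ncM.
have -> : good_count g g' eps n.+1 z =
    (good_count g g' eps n z + (eps <= nc (g' (iter n g z)))%R)%N.
  by rewrite /good_count big_ord_recr.
have := good_count_le g' g eps n z; move: (good_count _ _ _ _ _) IH => k IH kn.
have [ge|lt] := leP eps (nc (g' (iter n g z))).
  rewrite addn1 subSS exprSr mulrAC; apply: ler_pM; rewrite ?nc_ge0 //.
rewrite addn0 subSn // exprSr exprSr mulrACA; apply: ler_pM; rewrite ?nc_ge0 //.
by apply: (le_trans (ltW lt)); rewrite ler_peMl // ltW.
Qed.

(** More than [n / q] factors are below [(2 * L) ^- q], which together beats
    [(2 * L) ^- n]; the other factors are at most [L]. *)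
Lemma few_good_small_multiplier (K : set C) g g' (L : R) q n z : 1 <= L -> (0 < q)%N ->
  (forall z, K z -> nc (g' z) <= L) -> orbit_in K g n z ->
  (good_count g g' ((2 * L) ^+ q)^-1 n z < n - n %/ q)%N ->
  nc (multiplier g' g n z) <= (2 ^+ n)^-1.
Proof.
move=> L1 q0 hL oz; set eps := _^-1 => few.
have L0 : 0 < L by apply: lt_le_trans L1.
have L20 : 0 < 2 * L by rewrite mulr_gt0.
have L21 : 1 <= 2 * L by lra.
have e0 : 0 < eps by rewrite invr_gt0 exprn_gt0.
apply: (le_trans (multiplier_good_count L1 e0 hL oz)).
(* [n < (n %/ q).+1 * q], and there are at least [(n %/ q).+1] bad points. *)
have hb : (n <= q * (n - good_count g g' eps n z))%N.
  have h : (n %/ q < n - good_count g g' eps n z)%N.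
    by move: few; rewrite !ltn_subRL addnC.
  by apply: (leq_trans (ltnW (ltn_ceil n q0))); rewrite mulnC leq_mul2l h orbT.
rewrite /eps exprVn -exprM; apply: (@le_trans _ _ (L ^+ n / (2 * L) ^+ n)).
  rewrite ler_wpM2l ?exprn_ge0 ?(ltW L0) // lef_pV2 ?posrE ?exprn_gt0 //.
  by rewrite ler_weXn2l.
by rewrite exprMn invfM mulrCA divff ?mulr1 // expf_neq0 // gt_eqF.
Qed.

(** The point [y] is taken outside the image of the orbits with small multiplier,
    so that every branch of its tree has at least [n - n %/ q] good points. *)
Lemma separated_growth (V U : set C) g (N q : nat) : V !=set0 -> bounded_set V ->
  open V -> open U -> closure V `<=` U -> holomorphic_on U g -> (0 < N)%N ->
  (forall w, V w -> ((N%:R)%:E <= preimage_count V g w)%E) -> (0 < q)%N ->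
  exists2 delta : R, 0 < delta & \forall n \near \oo, exists s : seq C,
    [/\ uniq s, (N ^ (n - n %/ q) <= size s)%N &
        separated_set (closure V) g n delta [set` s]].
Proof.
move=> [p Vp] bV oV oU VU hU N0 pre q0.
have [cK [M M0 hM]] := compact_closure_bounded bV.
have [g' [hg' [L L1 hL] strict]] := uniform_strict cK oU VU hU.
have VK : V `<=` closure V := @subset_closure _ V.
have L0 : 0 < L by apply: lt_le_trans L1.
pose eps := ((2 * L) ^+ q)^-1.
have e0 : 0 < eps by rewrite invr_gt0 exprn_gt0 // mulr_gt0.
have [delta d0 inj] := uniform_injectivity strict e0.
have [rho rho0 Vrho] := open_ncP oV Vp.
exists delta => //.
have step w : V w ->
    (exists2 u, V u & g u = w /\ nc (g' u) < eps) \/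
    (exists s : seq C, [/\ uniq s, size s = N &
     forall u, u \in s -> [/\ V u, g u = w & eps <= nc (g' u)]]).
  move=> Vw; have [bad|nobad] := pselect (exists2 u, V u & g u = w /\ nc (g' u) < eps).
    by left.
  right; have good u : V u -> g u = w -> eps <= nc (g' u).
    by move=> Vu gu; rewrite leNgt; apply/negP => lt; apply: nobad; exists u.
  have [||||s [us szs hs]] := enough_preimages oU hU (N := N) (g' := g') (V := V) (w := w).
  - by move=> z /VK/VU.
  - by move=> z /VK/hg'.
  - by move=> u Vu gu; rewrite -nc_gt0; apply: lt_le_trans (good u Vu gu).
  - exact: pre.
  by exists s; split => // u /hs[Vu gu]; split => //; exact: good.
have c0 : 0 < rho / (32 * M) by rewrite divr_gt0 // mulr_gt0.
near=> n.
have n1 : (0 < n)%N by near: n; exists 1%N.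
have hn : 16 * M * (2 * (2 ^+ n)^-1) < rho.
  have : 1 / 2 ^+ n < rho / (32 * M).
    by near: n; exact: (near_infty_natSinv_expn_lt (PosNum c0)).
  rewrite div1r ltr_pdivlMr ?mulr_gt0 // => h.
  by apply: le_lt_trans h; rewrite le_eqVlt; apply/orP; left; apply/eqP; ring.
have e20 : 0 < (2 ^+ n)^-1 :> R by rewrite invr_gt0 exprn_gt0.
have [r r0 Hr] := iter_strict L1 hL strict n e20.
pose A := [set z | orbit_in (closure V) g n z /\
  nc (multiplier g' g n z) <= (2 ^+ n)^-1].
have c20 : 0 < 2 * (2 ^+ n)^-1 :> R by rewrite mulr_gt0.
have [||y yp miss] := @contraction_misses_point _ (iter n g) A p M
    (2 * (2 ^+ n)^-1) r rho M0 r0 rho0 c20 hn.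
- by move=> z [oz _]; apply: hM; exact: (oz 0%N).
- move=> z x [oz mz] xz.
  rewrite -[iter n g x - _](subrK (multiplier g' g n z * (x - z))).
  apply: (le_trans (ncD _ _)); rewrite [2 * _]mulr_natl mulr2n mulrDl; apply: lerD.
    exact: Hr.
  by rewrite ncM ler_wpM2r ?nc_ge0.
have Vy := Vrho y yp.
have sepV a b : V a -> V b -> eps <= nc (g' a) -> a <> b -> g a = g b ->
    delta < nc (a - b) by move=> /VK Ka /VK Kb; exact: inj.
have [|s [us hs seps] szs] := preimage_tree N0 step sepV (n := n)
    (m := (n - n %/ q)%N) Vy.
  move=> z oz zy; rewrite leqNgt; apply/negP => few.
  have oK : orbit_in (closure V) g n z.
    by move=> k kn; apply: VK; apply: oz; exact: ltnW.
  apply: (miss z) => //; split => //.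
  exact: (few_good_small_multiplier L1 q0 hL oK).
exists s; split => //; split.
- by move=> z /= /hs[oz _]; apply: VK; exact: (oz 0%N).
- by move=> z /= /hs[oz _] k kn; apply: VK; apply: oz; exact: ltnW.
- exact: seps.
Unshelve. all: by end_near. Qed.

Lemma counting_seq (s : seq C) : uniq s -> counting [set` s] = ((size s)%:R)%:E :> \bar R.
Proof.
move=> us; have fs : finite_set [set` s] by apply/finite_seqP; exists s.
rewrite /counting asboolT //; congr ((_%:R)%:E).
have := @fsbig_seq _ _ addn C s (fun=> 1%N) us.
by rewrite fsbig_finite //= !big_const_seq !count_predT !iter_addn_0 !mul1n => <-.
Qed.

Lemma limn_esup_ge (v : nat -> \bar R) (l : \bar R) :
  (\forall n \near \oo, (l <= v n)%E) -> (l <= limn_esup v)%E.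
Proof.
move=> near_l; apply: le_ereal_inf_tmp => _ [A A_oo <-].
have [n [An ln]] : exists n, A n /\ (l <= v n)%E.
  move: near_l A_oo => [n0 _ H0] [n1 _ H1]; exists (maxn n0 n1).
  by split; [apply: H1; exact: leq_maxr|apply: H0; exact: leq_maxl].
by apply: (le_trans ln); apply: ereal_sup_ubound; exists n.
Qed.

Lemma entropy_ge (X : set C) g (N q : nat) (delta : R) : (0 < N)%N -> (0 < q)%N ->
  0 < delta ->
  (\forall n \near \oo, exists s : seq C, [/\ uniq s, (N ^ (n - n %/ q) <= size s)%N &
        separated_set X g n delta [set` s]]) ->
  (((1 - q%:R^-1) * ln N%:R)%:E <= entropy_on X g)%E.
Proof.
move=> N0 q0 d0 H; apply: le_trans (ereal_sup_ubound _); last by exists delta.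
apply: limn_esup_ge; near=> n.
have n1 : (0 < n)%N by near: n; exists 1%N.
have [s [us szs seps]] : exists s : seq C, [/\ uniq s,
    (N ^ (n - n %/ q) <= size s)%N & separated_set X g n delta [set` s]] by near: n.
have NR : 1 <= N%:R :> R by rewrite ler1n.
have Npow : 0 < N%:R ^+ (n - n %/ q) :> R by rewrite exprn_gt0 // ltr0n.
have lemax : ((N%:R ^+ (n - n %/ q))%:E <= max_separated X g n delta)%E.
  apply: (@le_trans _ _ (counting [set` s])); last first.
    by apply: ereal_sup_ubound; exists [set` s].
  by rewrite counting_seq // lee_fin -natrX ler_nat.
have leln : ((ln (N%:R ^+ (n - n %/ q)))%:E <= lne (max_separated X g n delta))%E.
  rewrite -lne_EFin // lee_lne // in_itv /= leey andbT.
    by rewrite lee_fin ltW.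
  by apply: le_trans lemax; rewrite lee_fin ltW.
apply: (@le_trans _ _ ((n%:R^-1)%:E * (ln (N%:R ^+ (n - n %/ q)))%:E)%E); last first.
  by apply: lee_wpmul2l => //; rewrite lee_fin invr_ge0.
rewrite -EFinM lee_fin lnXn ?ltr0n // -[ln _ *+ _]mulr_natl mulrA.
rewrite ler_wpM2r ?ln_ge0 //.
rewrite ler_pdivlMl ?ltr0n // natrB ?leq_div // mulrBr mulr1 lerD2l lerN2.
by rewrite ler_pdivlMr ?ltr0n // -natrM ler_nat leq_divM.
Unshelve. all: by end_near. Qed.

End Growth.

Theorem theorem1p2 (R : realType) (V U : set (Cplx R)) (g : Cplx R -> Cplx R)
    (N : nat)
    (V_neq0 : V !=set0) (V_bounded : bounded_set V) (V_open : open V)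
    (U_open : open U) (VU : closure V `<=` U) (g_hol : holomorphic_on U g)
    (N_ge1 : (1 <= N)%N)
    (preimages : forall w, V w -> ((N%:R)%:E <= preimage_count V g w)%E) :
  ((ln N%:R)%:E <= topological_entropy (closure V) g)%E.
Proof.
have lnN : 0 <= ln N%:R :> R by rewrite ln_ge0 // ler1n.
apply: (@le_trans _ _ (entropy_on (closure V) g)); last first.
  apply: ereal_sup_ubound; exists (closure V) => //; split => //.
  by have [] := compact_closure_bounded V_bounded.
apply/lee_addgt0Pr => e e0.
have [q [q0 hq]] : exists q, (0 < q)%N /\ ln N%:R / q%:R <= e.
  have K0 : 0 < e / (1 + ln N%:R) by rewrite divr_gt0 // ltr_pwDl.
  have [m _ /(_ m (leqnn m)) /= h] := near_infty_natSinv_lt (PosNum K0).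
  exists m.+1; split => //; move: h; rewrite ltr_pdivlMr ?ltr_pwDl // mulrC => h.
  by apply/ltW; apply: le_lt_trans h; rewrite ler_wpM2r ?invr_ge0 // lerDr.
have [delta d0 H] := separated_growth V_neq0 V_bounded V_open U_open VU g_hol
  N_ge1 preimages q0.
(* The entropy at scale [delta] falls short of [ln N] by at most [ln N / q]. *)
have -> : ln N%:R = (1 - q%:R^-1) * ln N%:R + ln N%:R / q%:R :> R by ring.
rewrite EFinD; apply: leeD; first exact: (entropy_ge N_ge1 q0 d0 H).
by rewrite lee_fin.
Qed.
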